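(* For every integer $n\geq 2$ the following holds. (1) $e(\mathrm{PSL}_n(2))\leq 6$; (2) $e(\mathrm{PSL}_n(3))\leq 6$; (3) $e(\mathrm{PSU}_n(2))\leq 18$.
   Context: For a finite group $G$ and $g\in G$, $e_G(g)=e(g)$ is the smallest positive integer $k$ such that there are $x_1,\dots,x_k\in G$ with $g^{x_1}g^{x_2}\cdots g^{x_k}=1$, where $g^x=x^{-1}gx$. Put $e(G)=\max_{g\in G}e_G(g)$. $\mathrm{PSU}_n(2)$ is defined by a unitary space of dimension $n$ over $\mathbb{F}_4$. *)

(* Defs.v *)
From HB Require Import structures.
From mathcomp Require Import all_boot all_order all_fingroup all_algebra.
From mathcomp Require Import all_solvable all_field.

Set Implicit Arguments.
Unset Strict Implicit.
Unset Printing Implicit Defensive.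

Import GRing.Theory GroupScope.

Section ConjugateProducts.

Variable gT : finGroupType.
Implicit Types (G : {group gT}) (g : gT).

Definition trivial_conj_product G g (k : nat) : bool :=
  (0 < k)%N &&
  [exists x : {ffun 'I_k -> gT},
     [forall i, x i \in G] && (\prod_(i < k) g ^ x i == 1)].

(* Totality of e_elt: take all the x_i trivial and k the order of g. *)
Lemma trivial_conj_product_ex G g : exists k, trivial_conj_product G g k.
Proof.
exists #[g]; rewrite /trivial_conj_product order_gt0 /=.
apply/existsP; exists [ffun => 1]; apply/andP; split.
  by apply/forallP => i; rewrite ffunE.
under eq_bigr do rewrite ffunE conjg1.
by rewrite big_const_ord iter_mulg_1 expg_order.
Qed.

Definition e_elt G g : nat := ex_minn (trivial_conj_product_ex G g).

Definition e_group G : nat := \max_(g in G) e_elt G g.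

End ConjugateProducts.

(* As in the library, {'GL_n[F]} consists of matrices of size n.-1.+1, so the
   groups below are the intended ones only for n > 0. *)

Section SpecialLinear.

Variables (n : nat) (F : finFieldType).

Definition SLgroup := [set A : {'GL_n[F]} | (\det (GLval A) == 1)%R].

Lemma SLgroup_group_set : group_set SLgroup.
Proof.
apply/group_setP; split=> [|A B]; first by rewrite inE GL_1E det1.
by rewrite !inE => /eqP dA /eqP dB; rewrite GL_MxE det_mulmx dA dB mulr1.
Qed.
Canonical SLgroup_group := Group SLgroup_group_set.

Definition PSL : {group coset_of 'Z(SLgroup)} := (SLgroup / 'Z(SLgroup))%G.

End SpecialLinear.

Section SpecialUnitary.

(* GL_n(F) acts on row vectors on the right; f is a theta-hermitian form,
   linear in its first argument and theta-semilinear in the second. *)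
Variables (n : nat) (F : finFieldType) (theta : {rmorphism F -> F}).
Variable f : {hermitian_sym 'rV[F]_n.-1.+1 for theta}%R.

Definition SUgroup := [set A in SLgroup n F |
  [forall u : 'rV[F]_n.-1.+1, forall v : 'rV[F]_n.-1.+1,
     f (u *m GLval A)%R (v *m GLval A)%R == f u v]].

Lemma SUgroup_group_set : group_set SUgroup.
Proof.
apply/group_setP; split=> [|A B].
  rewrite inE group1; apply/forallP => u; apply/forallP => v.
  by rewrite GL_1E !mulmx1.
move=> /setIdP[sA /forallP fA] /setIdP[sB /forallP fB].
rewrite inE groupM //; apply/forallP => u; apply/forallP => v.
rewrite GL_MxE !mulmxA (eqP (forallP (fB _) _)).
exact: (forallP (fA u) v).
Qed.
Canonical SUgroup_group := Group SUgroup_group_set.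

Definition PSU : {group coset_of 'Z(SUgroup)} := (SUgroup / 'Z(SUgroup))%G.

End SpecialUnitary.

Section FieldOfOrder4.

Variables (F : finFieldType) (oF : #|F| = 4).

Lemma pchar_F4 : (2%N \in [pchar F])%R.
Proof. exact: (@card_finPcharP F 2 2). Qed.

Definition conj_F4 : F -> F := pFrobenius_aut pchar_F4.

HB.instance Definition _ :=
  GRing.RMorphism.copy conj_F4 (pFrobenius_aut pchar_F4).

Lemma conj_F4E x : conj_F4 x = (x ^+ 2)%R.
Proof. exact: pFrobenius_autE. Qed.

Lemma conj_F4K : involutive conj_F4.
Proof. by move=> x; rewrite !conj_F4E -exprM -[RHS]expf_card oF. Qed.

HB.instance Definition _ := isInvolutive.Build F conj_F4 conj_F4K.

End FieldOfOrder4.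

(* Main.v *)
(** If C is the matrix of a cyclic operator in a Krylov basis e, eC, eC^2, ... and
R is the reversal of that basis, then R C R agrees with C^-1 on all basis
vectors but one, so C (R C R) is the identity plus a matrix of
rank at most one.  Its order divides 2, 3 or 6 over F_2, F_3 or F_4, which makes a
product of 4, 6 or 12 conjugates of C trivial.  Since this is a statement about
blocks with a common number of factors, it suffices to split the space into cyclic
summands.  Over F_3 the reversal may have determinant -1, and then a sign change
of the last basis vector replaces it.

For the unitary group the summands must be orthogonal.  An isometry A whose
commuting idempotents give no orthogonal splitting is either hyperbolic (two dual
isotropic summands, which reduces to GL over F_4) or acts with a local algebra
F[A], hence cyclically, with annihilator p^k.  If p is fixed by the field
automorphism then A is real, because invariant hermitian forms are all congruent
by elements commuting with A.  Otherwise the same congruence lets one replace the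
form by a Toeplitz form with entries in F_2, for which the reversal is an
isometry. *)
Require Import Defs.
From mathcomp Require Import all_boot all_order all_fingroup all_algebra.
From mathcomp Require Import all_solvable all_field.
From mathcomp Require Import ring zify.

Set Implicit Arguments.
Unset Strict Implicit.
Unset Printing Implicit Defensive.

Import GRing.Theory.
Local Open Scope ring_scope.

(** * Trivial products of conjugates *)

Section ConjTrivial.
Variable F : finFieldType.

Lemma invmxM n (A B : 'M[F]_n) :
  A \in unitmx -> B \in unitmx -> invmx (A *m B) = invmx B *m invmx A.
Proof.
move=> uA uB; have uAB : A *m B \in unitmx by rewrite unitmx_mul uA.
by rewrite -[RHS](mulmxK uAB) mulmxA mulmxKV // mulVmx // mul1mx.
Qed.

(** The predicate [P] singles out the group from which the conjugators come. They are indexed by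
    [nat] so that sequences can be interleaved without casts between ordinals. *)
Definition conj_trivial K n (P : pred 'M[F]_n) (A : 'M[F]_n) :=
  exists X : nat -> 'M[F]_n,
    (forall i, (X i \in unitmx) && P (X i)) /\
    \prod_(i < K) (invmx (X i) *m A *m X i) = 1%:M.

Definition unimodular n (X : 'M[F]_n) := \det X == 1.

(** Conjugating every factor by [Y] conjugates the whole product. [P] and [Q] may differ because a
    change of basis changes the group, for instance the form it preserves. *)
Lemma conj_trivial_similar K n (P Q : pred 'M[F]_n) (A B Y : 'M[F]_n) :
    Y \in unitmx -> A *m Y = Y *m B ->
    (forall X, X \in unitmx -> P X -> Q (invmx Y *m X *m Y)) ->
  conj_trivial K P A -> conj_trivial K Q B.
Proof.
move=> uY AY PQ [X [uX X1]]; exists (fun i => invmx Y *m X i *m Y); split=> [i|].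
  by have /andP[ui Pi] := uX i; rewrite !unitmx_mul unitmx_inv uY ui PQ.
have -> : B = invmx Y *m A *m Y by rewrite -mulmxA AY mulKmx.
transitivity (invmx Y *m (\prod_(i < K) (invmx (X i) *m A *m X i)) *m Y); last
  first.
  by rewrite X1 mulmx1 mulVmx.
have cM : {morph (fun M => invmx Y *m M *m Y) : M N / M * N}.
  by move=> M N; rewrite -!mulmxE !mulmxA mulmxK.
rewrite (big_morph _ cM (_ : _ = 1)); last by rewrite mulmx1 mulVmx.
apply: eq_bigr => i _; have /andP[ui _] := uX i.
rewrite !invmxM ?unitmx_mul ?unitmx_inv ?uY ?ui // invmxK.
by rewrite !mulmxA !mulmxK.
Qed.

Lemma prod_block_diag K m n (A : nat -> 'M[F]_m) (B : nat -> 'M[F]_n) :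
  \prod_(i < K) block_mx (A i) 0 0 (B i) =
  block_mx (\prod_(i < K) A i) 0 0 (\prod_(i < K) B i).
Proof.
elim/big_rec3: _ => [|i a b c _ ->]; first by rewrite -scalar_mx_block.
by rewrite -!mulmxE mulmx_block !mul0mx !mulmx0 !addr0 !add0r.
Qed.

(** Products of block diagonal matrices are computed blockwise, so the two relations combine once
    they have the same number of factors. *)
Lemma conj_trivial_block K m n (P : pred 'M[F]_m) (Q : pred 'M[F]_n)
    (R : pred 'M[F]_(m + n)) A B :
    (forall X Y, P X -> Q Y -> R (block_mx X 0 0 Y)) ->
  conj_trivial K P A -> conj_trivial K Q B -> conj_trivial K R (block_mx A 0 0 B).
Proof.
move=> PQR [X [uX X1]] [Y [uY Y1]]; exists (fun i => block_mx (X i) 0 0 (Y i)).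
have uB i : block_mx (X i) 0 0 (Y i) \in unitmx.
  have [/andP[uXi _] /andP[uYi _]] := (uX i, uY i).
  by rewrite unitmxE det_ublock unitrM -!unitmxE uXi.
split=> [i|].
  by have [/andP[_ Pi] /andP[_ Qi]] := (uX i, uY i); rewrite uB PQR.
pose XA i := invmx (X i) *m A *m X i; pose YB i := invmx (Y i) *m B *m Y i.
have <- : \prod_(i < K) block_mx (XA i) 0 0 (YB i) = 1%:M.
  by rewrite prod_block_diag X1 Y1 -scalar_mx_block.
apply: eq_bigr => i _; rewrite invmx_block_diag // !mulmx_block.
by rewrite !(mul0mx, mulmx0, addr0, add0r).
Qed.

Lemma prod_alternating n (A B : nat -> 'M[F]_n) K :
  \prod_(i < K.*2) (if odd i then B i./2 else A i./2) =
  \prod_(i < K) (A i *m B i).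
Proof.
elim: K => [|K IH]; first by rewrite !big_ord0.
rewrite doubleS !big_ord_recr /= IH odd_double half_double.
by rewrite uphalf_double -!mulmxE mulmxA.
Qed.

(** Each conjugate by [Y i] of the product of [A] with its conjugate by [X] is a pair of conjugates
    of [A], by [Y i] and by [X *m Y i]. *)
Lemma conj_trivial_comp K n (P : pred 'M[F]_n) (A X : 'M[F]_n) :
    (forall Y, P Y -> P (X *m Y)) -> X \in unitmx ->
    conj_trivial K P (A *m (invmx X *m A *m X)) ->
  conj_trivial K.*2 P A.
Proof.
move=> PX uX [Y [uY Y1]].
exists (fun i => if odd i then X *m Y i./2 else Y i./2); split=> [i|].
  by have /andP[ui Pi] := uY i./2; case: ifP; rewrite ?unitmx_mul ?uX ui ?PX.
pose B1 i := invmx (Y i) *m A *m Y i.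
pose B2 i := invmx (Y i) *m (invmx X *m A *m X) *m Y i.
transitivity (\prod_(i < K) (B1 i *m B2 i)); last first.
  rewrite -Y1; apply: eq_bigr => i _; have /andP[ui _] := uY i.
  by rewrite /B1 /B2 !mulmxA mulmxK.
rewrite -prod_alternating; apply: eq_bigr => i _; have /andP[ui Pi] := uY i./2.
by case: (odd i) => //=; rewrite invmxM // /B2 !mulmxA.
Qed.

Lemma conj_trivial_expr K n (P : pred 'M[F]_n) (A : 'M[F]_n) :
  P 1%:M -> A ^+ K = 1%:M -> conj_trivial K P A.
Proof.
move=> P1 AK; exists (fun=> 1%:M); split=> [i|]; first by rewrite unitmx1.
by rewrite invmx1 mul1mx mulmx1 prodr_const card_ord.
Qed.
Lemma unimodular_unit n (X : 'M[F]_n) : unimodular X -> X \in unitmx.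
Proof. by rewrite unitmxE => /eqP->; apply: unitr1. Qed.

Lemma unimodular1 n : unimodular (1%:M : 'M[F]_n).
Proof. by rewrite /unimodular det1. Qed.

Lemma unimodularM n (X Y : 'M[F]_n) :
  unimodular X -> unimodular Y -> unimodular (X *m Y).
Proof. by rewrite /unimodular det_mulmx => /eqP-> /eqP->; rewrite mulr1. Qed.

Lemma unimodularJ n (X Y : 'M[F]_n) :
  Y \in unitmx -> unimodular X -> unimodular (invmx Y *m X *m Y).
Proof.
move=> uY /eqP dX; rewrite /unimodular !det_mulmx dX mulr1 det_inv mulVr //.
Qed.

End ConjTrivial.

(** * The reversal of a Krylov basis *)

Section Shift.
Variable F : finFieldType.

(** Companion matrices in the row convention: each basis row vector goes to the next one, and the
    last row is arbitrary. *)
Definition shift_mx n (C : 'M[F]_n) :=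
  forall i j : 'I_n, (i.+1 < n)%N -> C i j = (j == i.+1 :> nat)%:R.

Definition rev_mx n : 'M[F]_n := \matrix_(i, j) (j == rev_ord i)%:R.

Lemma rev_mxMl m n (M : 'M[F]_(m, n)) i j : (rev_mx m *m M) i j = M (rev_ord i) j.
Proof.
rewrite mxE (bigD1 (rev_ord i)) //= mxE eqxx mul1r big1 ?addr0 // => k ki.
by rewrite mxE (negPf ki) mul0r.
Qed.

Lemma rev_mxMr m n (M : 'M[F]_(m, n)) i j : (M *m rev_mx n) i j = M i (rev_ord j).
Proof.
rewrite mxE (bigD1 (rev_ord j)) //= mxE rev_ordK eqxx mulr1 big1 ?addr0 // => k ki.
by rewrite mxE -(inj_eq rev_ord_inj) rev_ordK eq_sym (negPf ki) mulr0.
Qed.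

Lemma rev_mxK n : rev_mx n *m rev_mx n = 1%:M.
Proof.
by apply/matrixP=> i j; rewrite rev_mxMl !mxE rev_ordK eq_sym.
Qed.

Lemma rev_mx_unit n : rev_mx n \in unitmx.
Proof. by case: (mulmx1_unit (rev_mxK n)). Qed.

Lemma invmx_rev n : invmx (rev_mx n) = rev_mx n.
Proof. by rewrite -[LHS]mulmx1 -(rev_mxK n) mulKmx ?rev_mx_unit. Qed.

Lemma det_rev_sqr n : \det (rev_mx n) ^+ 2 = 1.
Proof. by rewrite expr2 -det_mulmx rev_mxK det1. Qed.

Lemma shift_mulmx m n (C : 'M[F]_n) (M : 'M[F]_(n, m)) (i i' : 'I_n) j :
  shift_mx C -> i' = i.+1 :> nat -> (C *m M) i j = M i' j.
Proof.
move=> sC ii'; rewrite mxE (bigD1 i') //= sC -ii' ?ltn_ord // eqxx mul1r.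
rewrite big1 ?addr0 // => k; rewrite -val_eqE /= ii' => ki.
by rewrite sC -?ii' ?ltn_ord // ii' (negPf ki) mul0r.
Qed.

Definition last_row_mx n (N : 'M[F]_n) :=
  forall i j : 'I_n, (i.+1 < n)%N -> N i j = 0.

(** Only the last row is nonzero, so [N] has rank at most one and its square is its trace times
    itself. *)
Lemma last_row_mx_sqr n (N : 'M[F]_n.+1) :
  last_row_mx N -> N *m N = N ord_max ord_max *: N.
Proof.
move=> lN; apply/matrixP=> i j; rewrite !mxE (bigD1 ord_max) //= big1 ?addr0 =>
  [|k km].
  case: (eqVneq i ord_max) => [-> //|im]; rewrite !(lN i) ?mul0r ?mulr0 //;
  by rewrite ltnS ltn_neqAle im -ltnS ltn_ord.
by rewrite [N k j]lN ?mulr0 // ltnS ltn_neqAle km -ltnS ltn_ord.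
Qed.

Lemma det_last_row_mx n (N : 'M[F]_n.+1) :
  last_row_mx N -> \det (1%:M + N) = 1 + N ord_max ord_max.
Proof.
move=> lN; rewrite det_trig => [|]; last first.
  apply/is_trig_mxP => i j ij; rewrite !mxE lN; last exact: leq_trans (ltn_ord j).
  by rewrite -val_eqE (ltn_eqF ij) addr0.
rewrite (bigD1 ord_max) //= !mxE eqxx big1 ?mulr1 // => i im.
by rewrite !mxE eqxx lN ?addr0 // ltnS ltn_neqAle im -ltnS ltn_ord.
Qed.

(* The reversal carries the shift to its inverse away from the last basis
   vector, so this product fixes a hyperplane pointwise. *)
Lemma shift_rev_last_row n (C : 'M[F]_n) :
  shift_mx C -> last_row_mx (C *m (rev_mx n *m C *m rev_mx n) - 1%:M).
Proof.
move=> sC i j lti; rewrite mxE (shift_mulmx _ _ (i' := Ordinal lti)) //.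
rewrite rev_mxMr rev_mxMl sC /=; last by rewrite subnSK // ltn_subrL /=
  (leq_ltn_trans _ lti).
rewrite !mxE subnSK // eqn_sub2lE ?ltn_ord 1?ltnW // eqSS.
by rewrite -val_eqE eq_sym subrr.
Qed.

Lemma conj_trivial_rev K n (P : pred 'M[F]_n) (C : 'M[F]_n) :
    P 1%:M -> (forall Y, P Y -> P (rev_mx n *m Y)) ->
    (C *m (rev_mx n *m C *m rev_mx n)) ^+ K = 1%:M ->
  conj_trivial K.*2 P C.
Proof.
move=> P1 PR CK; apply: (conj_trivial_comp PR (rev_mx_unit n)).
by rewrite invmx_rev; apply: conj_trivial_expr.
Qed.

End Shift.

(** * Fields of order 2 and 4 *)

Section SmallFields.
Variable F : finFieldType.

Lemma mul_one_plus_scale n (N : 'M[F]_n.+1) nu a b :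
    N * N = nu *: N ->
  (1 + a *: N) * (1 + b *: N) = 1 + (a + b + a * b * nu) *: N.
Proof.
move=> NN; rewrite mulrDl mul1r mulrDr mulr1 -scalerAl -scalerAr NN !scalerA.
by rewrite !scalerDl -!addrA (addrCA (b *: N)).
Qed.

(** Let nu be the trace of [N]. In characteristic 2, (1 + N)^2 = 1 + nu N, which is 1 if nu = 0.
    Otherwise invertibility excludes nu = 1, hence the field of order 2; over the field of order 4,
    nu is a primitive cube root of unity and 1 + nu N has cube 1. The exponent is thus 2 or 6. *)
Lemma last_row_mx_expr_char2 n (N : 'M[F]_n.+1) :
    2%N \in [pchar F] -> (#|F| = 2 \/ #|F| = 4)%N -> last_row_mx N ->
    1%:M + N \in unitmx ->
  (1 + N) ^+ #|F|.-1.*2 = 1.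
Proof.
move=> ch2 oF lN uN; have NN : N * N = _ *: N := last_row_mx_sqr lN.
move: NN; move eqnu: (N _ _) => nu NN.
have nu1 : 1 + nu != 0.
  by move: uN; rewrite unitmxE det_last_row_mx // eqnu unitfE.
have x2 (x : F) : x + x = 0 by rewrite -mulr2n mulrn_pchar.
have sq : (1 + N) ^+ 2 = 1 + nu *: N.
  rewrite expr2 -[in LHS](scale1r N) (mul_one_plus_scale _ _ NN) x2 add0r.
  by rewrite !mul1r.
have n0 : nu != 0 -> nu ^+ #|F|.-1 = 1.
  by move=> nz; apply: (mulIf nz); rewrite -exprSr prednK ?mul1r ?expf_card
    ?cardT' //; apply/card_gt0P; exists 0.
have [nu0|nu0] := eqVneq nu 0.
  by rewrite -mul2n exprM sq nu0 scale0r addr0 expr1n.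
move: (n0 nu0); case: oF => -> /=; rewrite -mul2n exprM sq.
  by move=> nuE; move: nu1; rewrite -nuE expr1 x2 eqxx.
move=> nu3; rewrite exprS expr2 !(mul_one_plus_scale _ _ NN).
have -> : nu + (nu + nu + nu * nu * nu) + nu * (nu + nu + nu * nu * nu) * nu = 0.
  (* Multiplication by nu - 1 exhibits the factor nu^3 - 1 in the coefficient. *)
  have n1 : nu - 1 != 0.
    suff -> : nu - 1 = 1 + nu - (1 + 1) by rewrite x2 subr0.
    by ring.
  apply: (mulfI n1); rewrite mulr0 x2 add0r.
  have -> : (nu - 1) * (nu + nu * nu * nu + nu * (nu * nu * nu) * nu) =
            (nu ^+ 3 - 1) * (nu * (nu ^+ 2 - nu + 1)) by ring.
  by rewrite nu3 subrr mul0r.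
by rewrite scale0r addr0.
Qed.
End SmallFields.

(** * The field of order 3 *)

Section F3.
Variables (F : finFieldType) (oF : #|F| = 3).

Definition mx_of_rows m n (s : seq (seq F)) : 'M[F]_(m, n) :=
  \matrix_(i, j) nth 0 (nth [::] s i) j.

Lemma F3_cases (x : F) : [\/ x = 0, x = 1 | x = -1].
Proof.
have /eqP : x * ((x - 1) * (x + 1)) = 0.
  by rewrite mulrDr mulr1 mulrBl mul1r addrA subrK mulrBr mulr1 -expr2 -exprS
             -[X in x ^+ X]oF expf_card subrr.
rewrite !mulf_eq0 subr_eq0 addr_eq0 => /or3P[]/eqP; by [constructor
  1|constructor 2|constructor 3].
Qed.

Lemma F3_add11 : 1 + 1 = -1 :> F.
Proof.
have ch3 : 3%N \in [pchar F] := @card_finPcharP F 3 1 oF isT.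
by apply/eqP; rewrite -subr_eq0 opprK -(pcharf0 ch3) !mulrS addr0 addrA.
Qed.

Lemma F3_addxx (x : F) : x + x = - x.
Proof. by rewrite -[x in LHS]mul1r -mulrDl F3_add11 mulN1r. Qed.

Lemma F3_subNxx (x : F) : - x - x = x.
Proof. by rewrite F3_addxx opprK. Qed.

Ltac F3_simpl := rewrite ?big_ord_recl ?big_ord0 ?mxE /=
  ?(mul0r, mulr0, mul1r, mulr1, mulrN1, mulN1r, oppr0, @opprK F,
    addr0, add0r, addNr, subrr, F3_addxx, F3_subNxx).

Ltac mx_compute :=
  apply/matrixP; do 2! case=> [[|[|[|//]]] ? //]; do 3! F3_simpl; reflexivity.

Ltac det_compute :=
  do 3! (rewrite ?(expand_det_row _ ord0) /cofactor; F3_simpl);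
  rewrite ?det_mx00 ?det_mx11 ?(expr0, expr1, exprS); do 3! F3_simpl; reflexivity.

(** A certificate for a relation of length three that is checked by matrix products alone, without
    computing inverses. *)
Lemma conj_trivial3 n (A X1 Z1 X2 Z2 : 'M[F]_n) :
    unimodular X1 -> unimodular X2 ->
    A *m X1 = X1 *m Z1 -> A *m X2 = X2 *m Z2 -> A *m (Z1 *m Z2) = 1%:M ->
  conj_trivial 3 (@unimodular F n) A.
Proof.
move=> d1 d2 A1 A2 AZ; have u1 := unimodular_unit d1; have u2 := unimodular_unit d2.
exists (fun i => if i is i.+1 then if i is i.+1 then X2 else X1 else 1%:M).
split=> [[|[|i]]|]; rewrite ?unitmx1 ?unimodular1 ?u1 ?u2 //.
rewrite !big_ord_recl big_ord0 /= mulr1 invmx1 mul1mx mulmx1.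
by rewrite -!(mulmxA (invmx _)) A1 A2 !mulKmx.
Qed.

(* The conjugators were found by exhaustive search. *)
Lemma conj_trivial3_mx3 (b c : F) :
  conj_trivial 3 (@unimodular F 3)
    (mx_of_rows 3 3 [:: [:: 1; 0; 0]; [:: 0; -1; 0]; [:: c; b; -1]]).
Proof.
(* The entry [c] links the distinct eigenvalues 1 and -1, so a conjugation clears it; [c] itself
   serves as coefficient because 2c = -c. *)
pose Q := mx_of_rows 3 3 [:: [:: 1; 0; 0]; [:: 0; 1; 0]; [:: c; 0; 1]].
have dQ : unimodular Q by apply/eqP; rewrite /Q; det_compute.
apply: (@conj_trivial_similar _ 3 3 (@unimodular F 3) _
          (mx_of_rows 3 3 [:: [:: 1; 0; 0]; [:: 0; -1; 0]; [:: 0; b; -1]]) _ Q).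
- exact: unimodular_unit.
- by rewrite /Q; mx_compute.
- by move=> X _; apply: unimodularJ; apply: unimodular_unit.
pose sol A s1 t1 s2 t2 := @conj_trivial3 3 A
  (mx_of_rows 3 3 s1) (mx_of_rows 3 3 t1) (mx_of_rows 3 3 s2)
  (mx_of_rows 3 3 t2).
case: (F3_cases b) => ->.
- apply: (sol _ [:: [:: 0; 0; 1]; [:: 1; 0; 0]; [:: 0; 1; 0]]
    [:: [:: -1; 0; 0]; [:: 0; -1; 0]; [:: 0; 0; 1]]
    [:: [:: 0; 1; 0]; [:: 0; 0; 1]; [:: 1; 0; 0]]
    [:: [:: -1; 0; 0]; [:: 0; 1; 0]; [:: 0; 0; -1]]);
  first [mx_compute | apply/eqP; det_compute].
- apply: (sol _ [:: [:: 1; 0; 0]; [:: 0; 1; 1]; [:: 0; 0; 1]]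
    [:: [:: 1; 0; 0]; [:: 0; 1; -1]; [:: 0; 1; 0]]
    [:: [:: 1; 0; 0]; [:: 0; 0; 1]; [:: 0; -1; 0]]
    [:: [:: 1; 0; 0]; [:: 0; -1; -1]; [:: 0; 0; -1]]);
  first [mx_compute | apply/eqP; det_compute].
apply: (sol _ [:: [:: 1; 0; 0]; [:: 0; 0; 1]; [:: 0; -1; 0]]
    [:: [:: 1; 0; 0]; [:: 0; -1; 1]; [:: 0; 0; -1]]
    [:: [:: 1; 0; 0]; [:: 0; 1; 1]; [:: 0; 0; 1]]
    [:: [:: 1; 0; 0]; [:: 0; 0; 1]; [:: 0; -1; 1]]);
  first [mx_compute | apply/eqP; det_compute].
Qed.

(** Outside its last row [Y] is diagonal, with a single -1 just before the last position. The first
    [m] entries of the last row link the eigenvalues 1 and -1, so they can be cleared, which leaves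
    an identity block and a 3 by 3 block. *)
Lemma conj_trivial3_lower_block m (Y : 'M[F]_(m + 3)) :
    (forall i j : 'I_(m + 3), (i.+1 < m + 3)%N ->
       Y i j = (-1) ^+ (i == m.+1 :> nat) * (j == i)%:R) ->
    (forall i : 'I_(m + 3), i.+1 = (m + 3)%N -> Y i i = -1) ->
  conj_trivial 3 (@unimodular F (m + 3)) Y.
Proof.
move=> Yu Yd; pose Z := dlsubmx Y; pose Y3 := drsubmx Y.
have Yl (i : 'I_m) j : Y (lshift 3 i) j = (j == lshift 3 i)%:R.
  have im := ltn_ord i; rewrite Yu /= ?ltn_eqF ?mul1r //; first exact: ltnW.
  by rewrite addn3 !ltnS ltnW // ltnW.
have Yr (i : 'I_3) j : (i < 2)%N ->
    Y (rshift m i) j = (-1) ^+ (i == 1 :> nat) * (j == rshift m i)%:R.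
  move=> i2; rewrite Yu /=; last by rewrite -addnS ltn_add2l ltnS.
  by rewrite -[in X in (-1) ^+ (_ == X)](addn1 m) eqn_add2l.
have EY : Y = block_mx 1%:M 0 Z Y3.
  rewrite -[LHS]submxK; congr block_mx; apply/matrixP=> i j; rewrite !mxE Yl.
    by rewrite eq_sym (inj_eq (@lshift_inj _ _)).
  by rewrite eq_sym eq_lrshift.
have Zi (i : 'I_3) j : (i < 2)%N -> Z i j = 0.
  by move=> i2; rewrite !mxE Yr // eq_lrshift mulr0.
have Y32 (i : 'I_3) : Y3 i ord_max = - (i == ord_max)%:R.
  rewrite !mxE; case: (eqVneq i ord_max) => [->|i2].
    by rewrite Yd //= addn2 addn3.
  have i2' : (i < 2)%N by rewrite ltn_neqAle i2 -ltnS ltn_ord.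
  by rewrite Yr // (inj_eq (@rshift_inj _ _)) [ord_max == i]eq_sym (negPf i2)
    mulr0 oppr0.
(* Only the last row of [Z] is nonzero, so Y3 Z = -Z, and Z - Y3 Z = 2Z = -Z is the required
   intertwining relation. *)
pose Q : 'M[F]_(m + 3) := block_mx 1%:M 0 (- Z) 1%:M.
have dQ : unimodular Q by rewrite /unimodular det_lblock !det1 mulr1.
apply: (conj_trivial_similar (P := @unimodular F _)
         (A := block_mx 1%:M 0 0 Y3) (Y := invmx Q)).
- by rewrite unitmx_inv unimodular_unit.
- have uQ := unimodular_unit dQ.
  suff YQ : Y *m Q = Q *m block_mx 1%:M 0 0 Y3.
    by rewrite -[LHS](mulKmx uQ) [Q *m _]mulmxA -YQ mulmxK.
  rewrite EY !mulmx_block !(mulmx0, mul0mx, mul1mx, mulmx1, addr0, add0r).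
  congr block_mx; apply/matrixP => i j.
  rewrite mxE [RHS]mxE [X in _ + X]mxE (bigD1 ord_max) //= Y32 big1 => [|k k2].
    rewrite [(- Z) ord_max j]mxE; case: (eqVneq i ord_max) => [->|i2].
      by rewrite addr0 mulN1r opprK F3_addxx.
    have i2' : (i < 2)%N by rewrite ltn_neqAle i2 -ltnS ltn_ord.
    by rewrite Zi // oppr0 mul0r !addr0.
  rewrite [(- Z) k j]mxE Zi ?oppr0 ?mulr0 //.
  by rewrite ltn_neqAle k2 -ltnS ltn_ord.
- by move=> X _; apply: unimodularJ; rewrite unitmx_inv unimodular_unit.
apply: (conj_trivial_block (P := @unimodular F m) (Q := @unimodular F 3)).
- by move=> X X'; rewrite /unimodular det_lblock => /eqP-> /eqP->; rewrite mulr1.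
- by apply: conj_trivial_expr; rewrite ?unimodular1 // expr1n.
have E3 : Y3 = mx_of_rows 3 3 [:: [:: 1; 0; 0]; [:: 0; -1; 0];
    [:: Y3 ord_max ord0; Y3 ord_max (lift ord0 ord0); -1]].
  apply/matrixP=> i j; rewrite [RHS]mxE.
  have [->|i2] := eqVneq i ord_max.
    have [->|j2] := eqVneq j ord_max; first by rewrite Y32 eqxx.
    by case: j j2 => [[|[|[|//]]] ?] //= _; congr (Y3 _ _); apply: val_inj.
  have i2' : (i < 2)%N by rewrite ltn_neqAle i2 -ltnS ltn_ord.
  rewrite !mxE Yr // (inj_eq (@rshift_inj _ _)) -val_eqE.
  by case: i j i2' {i2} => [[|[|//]] ?] [[|[|[|//]]] ?] //= _;
    rewrite ?mulr0 ?mulr1.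
by rewrite E3; apply: conj_trivial3_mx3.
Qed.

Lemma conj_trivial3_lower n (Y : 'M[F]_n) : (2 < n)%N ->
    (forall i j : 'I_n, (i.+1 < n)%N ->
       Y i j = (-1) ^+ (i.+2 == n) * (j == i)%:R) ->
    (forall i : 'I_n, i.+1 = n -> Y i i = -1) ->
  conj_trivial 3 (@unimodular F n) Y.
Proof.
move=> n2; have [m e] : exists m, n = (m + 3)%N by exists (n - 3)%N; rewrite subnK.
subst n => Yu Yd; apply: conj_trivial3_lower_block => // i j lti.
by rewrite Yu //; congr ((-1) ^+ (_ : bool) * _); move: (i : nat) => k; rewrite
  addn3 !eqSS.
Qed.

(** The companion matrices C of size 2 and determinant 1 are too small for the argument with a 3 by
    3 block. If c = 0, then C is conjugate to -C, and C times -C is 1. Otherwise c^2 = 1, so C^3 =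
    -c and C^6 = 1. *)
Lemma conj_trivial_shift2 (c : F) :
  conj_trivial 6 (@unimodular F 2) (mx_of_rows 2 2 [:: [:: 0; 1]; [:: -1; c]]).
Proof.
have cube (d : F) : d ^+ 2 = 1 ->
    mx_of_rows 2 2 [:: [:: 0; 1]; [:: -1; d]] ^+ 3 = (- d)%:M :> 'M[F]_2.
  move=> d2; have dd x : d * (d * x) = x by rewrite mulrA -expr2 d2 mul1r.
  rewrite !exprS expr0 mulr1 -!mulmxE.
  have -> : mx_of_rows 2 2 [:: [:: 0; 1]; [:: -1; d]] *m
            mx_of_rows 2 2 [:: [:: 0; 1]; [:: -1; d]] =
            mx_of_rows 2 2 [:: [:: -1; d]; [:: - d; 0]].
    apply/matrixP; do 2! case=> [[|[|//]] ?]; F3_simpl; F3_simpl; rewrite //.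
    by rewrite -expr2 d2 addrC subrr.
  apply/matrixP; do 2! case=> [[|[|//]] ?]; F3_simpl; F3_simpl; rewrite //=.
    by rewrite mulrN -expr2 d2 subrr.
have [-> | c1] : c = 0 \/ c ^+ 2 = 1.
- by case: (F3_cases c) => ->; [left | right; rewrite expr1n | right; rewrite
  sqrrN expr1n].
- pose X : 'M[F]_2 := mx_of_rows 2 2 [:: [:: 1; 1]; [:: 1; -1]].
  have dX : unimodular X by apply/eqP; rewrite /X; det_compute.
  apply: (@conj_trivial_comp _ 3 _ (@unimodular F _) _ X); [by move=> Y; apply:
    unimodularM | exact: unimodular_unit |].
  apply: conj_trivial_expr; first exact: unimodular1.
  set C := mx_of_rows _ _ _; have CX : C *m X = X *m - C by rewrite /C /X;
    mx_compute.
  rewrite -!mulmxA CX mulKmx ?unimodular_unit //.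
  have -> : C *m - C = 1%:M by rewrite /C; mx_compute.
  exact: expr1n.
apply: conj_trivial_expr; rewrite ?unimodular1 // (exprM _ 3 2) cube //.
by rewrite expr2 -mulmxE -scalar_mxM mulrNN -expr2 c1.
Qed.

Lemma conj_trivial_shift_F3 n (C : 'M[F]_n) :
  shift_mx C -> C \in unitmx -> conj_trivial 6 (@unimodular F n) C.
Proof.
case: n C => [|n] C sC uC.
  by apply: conj_trivial_expr; [apply: unimodular1 | apply/matrixP=> [[]]].
have sq1 (x : F) : x != 0 -> x ^+ 2 = 1.
  by case: (F3_cases x) => -> //; rewrite ?eqxx ?expr1n // sqrrN expr1n.
pose R := rev_mx F n.+1; have uR : R \in unitmx := rev_mx_unit F n.+1.
have dR2 : \det R ^+ 2 = 1 := det_rev_sqr F n.+1.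
have dC2 : \det C ^+ 2 = 1 by apply: sq1; move: uC; rewrite unitmxE unitfE.
(* This product has determinant 1, so its rank one part has trace 0 and it is trivial or a
   transvection, of order dividing 3. *)
have T3 : (C *m (R *m C *m R)) ^+ 3 = 1.
  have := shift_rev_last_row sC; rewrite -/R; set T := _ *m _ => lN.
  have := det_last_row_mx lN; have := last_row_mx_sqr lN.
  set N := T - _ in lN *; move: (N _ _) => nu NN.
  have {}NN : N * N = nu *: N by [].
  have TN : T = 1 + 1 *: N by rewrite scale1r /N addrC subrK.
  have -> : \det (1%:M + N) = 1.
    by rewrite /N addrC subrK /T !det_mulmx mulrAC -expr2 dR2 mul1r -expr2 dC2.
  move=> /(congr1 (fun x => x - 1)); rewrite subrr addrC addKr => nu0.
  rewrite -{}nu0 in NN.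
  rewrite TN exprS expr2 !(mul_one_plus_scale _ _ NN) !mulr0 !addr0.
  by rewrite (F3_addxx) subrr scale0r addr0.
have viaX (X : 'M[F]_n.+1) : unimodular X -> C *m X = X *m (R *m C *m R) ->
    conj_trivial 6 (@unimodular F n.+1) C.
  move=> dX CX; have uX := unimodular_unit dX.
  apply: (@conj_trivial_comp _ 3 _ (@unimodular F _) _ X) => // [Y|]; first
    exact: unimodularM.
  by apply: conj_trivial_expr; rewrite ?unimodular1 // -mulmxA CX mulKmx.
have [dR1|dR1] := eqVneq (\det R) 1.
  apply: (viaX R); first by rewrite /unimodular dR1.
  by rewrite !mulmxA rev_mxK mul1mx.
have {}dR1 : \det R = -1.
  by move: dR2 dR1 => /eqP; rewrite -subr_eq0 subr_sqr_1 mulf_eq0 subr_eq0 addr_eq0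
    => /orP[/eqP->|/eqP->]; rewrite ?eqxx.
(* If det C = -1, then [C *m R] has determinant 1 and conjugates [C] exactly as [R] does. *)
have [dC1|dC1] := eqVneq (\det C) 1; last first.
  have {}dC1 : \det C = -1.
    by move: dC2 dC1 => /eqP; rewrite -subr_eq0 subr_sqr_1 mulf_eq0 subr_eq0
      addr_eq0
      => /orP[/eqP->|/eqP->]; rewrite ?eqxx.
  apply: (viaX (C *m R)); first by rewrite /unimodular det_mulmx dC1 dR1 mulrNN
    mulr1.
  by rewrite -!mulmxA (mulmxA R R) rev_mxK mul1mx.
(* Now det C = 1 and det R = -1. Sizes 1 and 2 are treated apart, since the general case isolates a
   3 by 3 block. *)
case: n => [|[|m]] in C sC uC R uR dR2 dC2 T3 viaX dR1 dC1 *.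
- have := viaX C; apply; first by rewrite /unimodular dC1.
  suff -> : R = 1%:M by rewrite mul1mx mulmx1.
  by apply/matrixP=> i j; rewrite !mxE !ord1.
- suff -> : C = mx_of_rows 2 2 [:: [:: 0; 1]; [:: -1; C ord_max ord_max]].
    exact: conj_trivial_shift2.
  have C0 j : C ord0 j = (j == 1 :> nat)%:R by rewrite sC.
  apply/matrixP; do 2! case=> [[|[|//]] ?]; rewrite mxE /=.
  + by rewrite (_ : Ordinal _ = ord0) ?C0 //; apply: val_inj.
  + by rewrite (_ : Ordinal _ = ord0) ?C0 //; apply: val_inj.
  + move: dC1; rewrite (expand_det_row _ ord0) !big_ord_recl big_ord0 !C0 /=.
    rewrite /cofactor mul0r add0r mul1r addr0 expr1 mulN1r.
    by move=> <-; rewrite opprK det_mx11 !mxE; congr (C _ _); apply: val_inj.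
  by congr (C _ _); apply: val_inj.
(* Flipping the sign of the last basis vector makes [X] unimodular, at the cost of signs -1 in the
   last two diagonal entries of the product [Y]. *)
pose d := \row_(j < m.+3) (-1) ^+ (j.+1 == m.+3) : 'rV[F]_m.+3.
pose D := diag_mx d; pose X := R *m D.
have DK : D *m D = 1%:M.
  apply/matrixP=> i j; rewrite mul_diag_mx !mxE.
  by rewrite mulrnAr -expr2 sqrr_sign.
have uD : D \in unitmx by case: (mulmx1_unit DK).
have dD : \det D = -1.
  rewrite det_diag (bigD1 ord_max) //= mxE eqxx big1 ?mulr1 // => i im.
  by rewrite mxE eqSS [_ == _](negPf im).
have dX : unimodular X by rewrite /unimodular det_mulmx dR1 dD mulrNN mulr1.
apply: (@conj_trivial_comp _ 3 _ (@unimodular F _) _ X) => [Y||]; first exact: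
  unimodularM.
  exact: unimodular_unit.
have -> : invmx X = D *m R.
  rewrite invmxM // invmx_rev; congr (_ *m _).
  by rewrite -[LHS]mulmx1 -DK mulKmx.
set Y := C *m _.
have Yu (i j : 'I_m.+3) : (i.+1 < m.+3)%N -> 
    Y i j = (-1) ^+ (i.+2 == m.+3) * (j == i)%:R.
  move=> lti; pose i' := Ordinal lti.
  have RCR : (R *m C *m R) i' j = (i == j)%:R.
    have := shift_rev_last_row sC j lti; rewrite -/R; set T := C *m _.
    have -> : (T - 1%:M) i j = T i j - (i == j)%:R by rewrite !mxE.
    by rewrite /T (shift_mulmx _ _ (i' := i')) // => /eqP; rewrite subr_eq0 => /eqP.
  rewrite /Y (shift_mulmx _ _ (i' := i')) //.
  have -> : D *m R *m C *m X = D *m (R *m C *m R) *m D by rewrite /X !mulmxA.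
  rewrite mul_mx_diag mxE mul_diag_mx mxE RCR !mxE /=.
  case: (eqVneq i j) => [<-|ij]; rewrite ?mulr1 ?(ltn_eqF lti) ?expr0 ?mulr1 //.
  by rewrite !(mulr0, mul0r).
apply: conj_trivial3_lower => // i im.
have {im} -> : i = ord_max by apply: val_inj; case: im.
(* [Y] is lower triangular of determinant 1, and exactly one of its earlier diagonal entries is -1,
   so the last one is -1 as well. *)
have dY : \det Y = 1.
  rewrite /Y !det_mulmx dR1 dD dC1; by rewrite !(mulrNN, mul1r, mulr1).
move: dY; rewrite det_trig; last first.
  apply/is_trig_mxP => k l kl; rewrite Yu; last exact: leq_ltn_trans kl (ltn_ord l).
  by rewrite -val_eqE (gtn_eqF kl) mulr0.
have im2 : (m.+1 < m.+3)%N by [].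
rewrite (bigD1 ord_max) //= (bigD1 (Ordinal im2)) //=.
rewrite (Yu (Ordinal im2)) //= !eqxx big1 => [|k /andP[k1 k2]]; last first.
  have lk : (k.+1 < m.+3)%N by rewrite ltnS ltn_neqAle k1 -ltnS ltn_ord.
  by rewrite (Yu k) // eqxx mulr1 !eqSS [_ == m.+1](negPf k2).
- by rewrite !mulr1 mulrN1 => /eqP; rewrite eqr_oppLR => /eqP.
by rewrite -val_eqE /= neq_ltn ltnSn.
Qed.
End F3.

(** * Primary and cyclic decomposition *)

Section Primary.
Variable F : finFieldType.

(** This says that F[A] is a local algebra: a finite commutative ring without idempotents other than
    0 and 1 is local. *)
Definition local_mx n (A : 'M[F]_n.+1) := forall q, let E := horner_mx A q in
  E *m E = E -> E = 0 \/ E = 1%:M.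

(** By finiteness the powers of [B] are eventually periodic, and an exponent that is a multiple of
    the period beyond the preperiod gives an idempotent. *)
Lemma idempotent_power n (B : 'M[F]_n.+1) :
  exists2 e, (0 < e)%N & B ^+ e * B ^+ e = B ^+ e.
Proof.
pose f (i : 'I_(#|{: 'M[F]_n.+1}|.+1)) := B ^+ i.
have /injectivePn[i [j ij fij]] : ~~ injectiveb f.
  by apply/negP=> /injectiveP/leq_card; rewrite card_ord ltnn.
wlog lt_ij : i j ij fij / (i < j)%N.
  have := ij; rewrite neq_ltn => /orP[] lt W; first exact: (W i j).
  by apply: (W j i); rewrite // eq_sym.
pose c := (j - i)%N; have c0 : (0 < c)%N by rewrite subn_gt0.
have step m : (i <= m)%N -> B ^+ (m + c) = B ^+ m.
  move=> im; rewrite -{1}(subnK im) -addnA subnKC 1?ltnW // exprD.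
  by rewrite -[B ^+ j]fij -exprD subnK.
have per k t : (i <= k)%N -> B ^+ (k + t * c) = B ^+ k.
  move=> ik; elim: t => [|t IH]; first by rewrite addn0.
  by rewrite mulSnr addnA step // (leq_trans ik) ?leq_addr.
exists (i.+1 * c)%N; first by rewrite muln_gt0 c0.
by rewrite -exprD per // (leq_trans (leqnSn i)) // leq_pmulr.
Qed.

Lemma local_mx_nilpotent n (A : 'M[F]_n.+1) q : local_mx A ->
  horner_mx A q \notin unitmx -> exists e, horner_mx A (q ^+ e) = 0.
Proof.
move=> lA qu; have [e e0 ee] := idempotent_power (horner_mx A q).
have := lA (q ^+ e); rewrite rmorphXn /= mulmxE ee => /(_ erefl)[E0|E1].
  by exists e; rewrite rmorphXn.
case/negP: qu; case: e e0 {ee} E1 => // e _; rewrite exprS -mulmxE.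
by case/mulmx1_unit.
Qed.

(** The minimal polynomial of [A] is p^(k+1); the shift keeps its exponent positive and makes p^k(A)
    a generator of the least nonzero ideal of F[A]. *)
Definition primary_data n (A : 'M[F]_n.+1) (p : {poly F}) k :=
  [/\ irreducible_poly p, p \is monic, horner_mx A (p ^+ k.+1) = 0
    & horner_mx A (p ^+ k) != 0].

(** A monic polynomial [p] of least degree with p(A) singular is irreducible, because a singular
    product has a singular factor. As a non-unit of a local algebra, p(A) is nilpotent. *)
Lemma local_mx_primary n (A : 'M[F]_n.+1) :
  local_mx A -> exists p k, primary_data A p k.
Proof.
(* Row vectors code the polynomials of bounded size, which makes the search for the least degree
   decidable. *)
move=> lA; pose P d := [exists x : 'rV[F]_d,
  (rVpoly x \is monic) && (horner_mx A (rVpoly x) \notin unitmx)].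
have n0 : (0 : 'M[F]_n.+1) \notin unitmx by rewrite unitmxE det0 unitr0.
have exP : exists d, P d.
  exists n.+2; apply/existsP; exists (poly_rV (char_poly A)).
  rewrite poly_rV_K ?size_char_poly // char_poly_monic.
  by rewrite Cayley_Hamilton.
case: (ex_minnP exP) => d /existsP[x /andP[pm pA]] min.
set p := rVpoly x in pm pA.
have minp q : q != 0 -> horner_mx A q \notin unitmx -> (size p <= size q)%N.
  move=> q0 qA; apply: leq_trans (size_poly _ _) (min _ _).
  have lq : (lead_coef q)^-1 != 0 by rewrite invr_eq0 lead_coef_eq0.
  apply/existsP; exists (poly_rV ((lead_coef q)^-1 *: q)).
  rewrite poly_rV_K ?size_scale // monicE lead_coefZ mulVf ?lead_coef_eq0 // eqxx.
  by rewrite horner_mxZ unitmxZ // unitfE.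
have p0 : p != 0 := monic_neq0 pm.
have irr : irreducible_poly p.
  split=> [|q q1 qp].
    rewrite ltnNge; apply: contra pA => /size1_polyC pC.
    by rewrite pC horner_mx_C unitmxE det_scalar unitrX // unitfE -polyC_eq0 -pC.
  have q0 : q != 0 by apply: contraNneq p0 => q0; rewrite q0 dvd0p in qp.
  move: (qp) => /dvdpP[r pE]; have r0 : r != 0.
    by apply: contraNneq p0 => r0; rewrite pE r0 mul0r.
  have [qA|qA] := boolP (horner_mx A q \in unitmx); last first.
    by rewrite -dvdp_size_eqp // eqn_leq minp // dvdp_leq.
  have rA : horner_mx A r \notin unitmx.
    by apply: contra pA => rA; rewrite pE rmorphM -mulmxE unitmx_mul rA.
  have := minp r r0 rA; rewrite pE size_mul // -subn1 leq_subLR [(1 + _)%N]addnC.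
  rewrite leq_add2l; move: q0; rewrite -size_poly_gt0.
  by case: (size q) q1 => [|[|s]].
have exk : exists e, horner_mx A (p ^+ e) == 0.
  by have [e eA] := local_mx_nilpotent lA pA; exists e; apply/eqP.
case: (ex_minnP exk) => -[|k]; first by rewrite expr0 rmorph1 oner_eq0.
move=> /eqP pk mink; exists p, k; split=> //.
by apply/negP=> /mink; rewrite ltnn.
Qed.

Lemma irreducible_valuation (p r : {poly F}) : irreducible_poly p -> r != 0 ->
  exists i s, r = p ^+ i * s /\ coprimep p s.
Proof.
move=> ip; have [m] := ubnP (size r); elim: m r => // m IH r rm r0.
have [pr|pr] := boolP (p %| r); last first.
  exists 0, r; rewrite expr0 mul1r; split=> //.
  rewrite coprimep_def; apply: contraNT pr => g1.
  by rewrite -(eqp_dvdl _ (ip _ g1 (dvdp_gcdl _ _))) dvdp_gcdr.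
have [t rE] := dvdpP _ _ pr; have t0 : t != 0.
  by apply: contraNneq r0 => t0; rewrite rE t0 mul0r.
have [|i [s [tE ps]]] := IH t _ t0.
  rewrite ltnS in rm; apply: leq_trans rm.
  rewrite rE size_mul ?(irredp_neq0 ip) //.
  by case: (size p) (ip.1) => [|[|a]] // _; rewrite !addnS /= ltnS leq_addr.
by exists i.+1, s; rewrite rE tE exprSr mulrAC.
Qed.

(** Write r = p^i s with s prime to p. Then s is invertible modulo p^(k+1) and i is at most k, so
    p^k is a multiple of r modulo p^(k+1). *)
Lemma primary_divides n (A : 'M[F]_n.+1) p k r : primary_data A p k ->
  horner_mx A r != 0 -> exists c, horner_mx A (r * c) = horner_mx A (p ^+ k).
Proof.
move=> [ip pm pA _] rA.
have r0 : r != 0 by apply: contraNneq rA => ->; rewrite rmorph0.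
have [i [s [rE ps]]] := irreducible_valuation ip r0.
have ik : (i <= k)%N.
  rewrite leqNgt; apply: contra rA => ki; rewrite rE -(subnK ki) exprD.
  by rewrite !rmorphM /= [X in _ * X * _]pA mulr0 mul0r.
have /Bezout_eq1_coprimepP[[u w] /= uw] : coprimep (p ^+ k.+1) s.
  by rewrite coprimep_pexpl.
exists (w * p ^+ (k - i)); rewrite rE.
have -> : p ^+ i * s * (w * p ^+ (k - i)) = p ^+ k * (1 - u * p ^+ k.+1).
  rewrite -uw addrC addKr -{2}(subnK ik) exprD; ring.
by rewrite mulrBr mulr1 rmorphB mulrA rmorphM /= pA mulr0 subr0.
Qed.

Lemma primary_annihilator n (A : 'M[F]_n.+1) p k r : primary_data A p k ->
  horner_mx A r = 0 -> p ^+ k.+1 %| r.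
Proof.
move=> [ip pm pA pA'] rA; have [->|r0] := eqVneq r 0; first exact: dvdp0.
have [i [s [rE ps]]] := irreducible_valuation ip r0.
have [ki|ik] := ltnP k i; first by rewrite rE dvdp_mulr // dvdp_exp2l.
have /Bezout_eq1_coprimepP[[u w] /= uw] : coprimep (p ^+ k.+1) s.
  by rewrite coprimep_pexpl.
case/eqP: pA'.
have -> : p ^+ k = u * p ^+ k * p ^+ k.+1 + w * p ^+ (k - i) * r.
  rewrite rE -[LHS]mulr1 -uw -{1 3}(subnK ik) exprD; ring.
by rewrite rmorphD !rmorphM /= pA rA !mulr0 addr0.
Qed.
End Primary.

(** * Krylov bases and cyclic summands *)

Section Krylov.
Variable F : finFieldType.

Definition krylov n d (A : 'M[F]_n.+1) (v : 'rV[F]_n.+1) : 'M[F]_(d, n.+1) :=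
  \matrix_(i < d) (v *m A ^+ i).

(** Coordinates with respect to the Krylov family are polynomial coefficients, which turns linear
    algebra on a cyclic subspace into arithmetic in F[A]. *)
Lemma mul_krylov n d (A : 'M[F]_n.+1) v (x : 'rV[F]_d) :
  x *m krylov d A v = v *m horner_mx A (rVpoly x).
Proof.
have -> : rVpoly x = \sum_(i < d) (x 0 i)%:P * 'X^i.
  rewrite [LHS]poly_def; apply: eq_bigr => i _; rewrite valK mul_polyC.
  by congr (_ *: _).
rewrite rmorph_sum /= mulmx_sumr mulmx_sum_row; apply: eq_bigr => i _.
rewrite rmorphM /= rmorphXn /= horner_mx_C horner_mx_X rowK -mulmxE.
by rewrite mulmxA -scalemx1 -scalemxAr mulmx1 scalemxAl.
Qed.

Lemma mul_poly_krylov n d (A : 'M[F]_n.+1) v (q : {poly F}) : (size q <= d)%N ->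
  poly_rV q *m krylov d A v = v *m horner_mx A q.
Proof. by move=> sq; rewrite mul_krylov poly_rV_K. Qed.

Lemma horner_mx_intertwine m n (A : 'M[F]_n.+1) (C : 'M[F]_m.+1)
    (K : 'M[F]_(m.+1, n.+1)) q :
  K *m A = C *m K -> K *m horner_mx A q = horner_mx C q *m K.
Proof.
move=> KA; elim/poly_ind: q => [|q c IH]; first by rewrite !rmorph0 mulmx0 mul0mx.
rewrite !rmorphD !rmorphM /= !horner_mx_X !horner_mx_C mulmxDr mulmxDl.
rewrite -!mulmxE mulmxA IH -!mulmxA KA; congr (_ + _).
by rewrite mul_scalar_mx mul_mx_scalar.
Qed.

Lemma stable_horner n l (A : 'M[F]_n.+1) (L : 'M[F]_(n.+1, l)) q (u : 'rV_n.+1) :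
    (forall u : 'rV[F]_n.+1, u *m L = 0 -> u *m A *m L = 0) ->
  u *m L = 0 -> u *m horner_mx A q *m L = 0.
Proof.
move=> st; elim/poly_ind: q u => [|q c IH] u uL; first by rewrite rmorph0
  mulmx0 mul0mx.
rewrite rmorphD rmorphM /= horner_mx_X horner_mx_C mulmxDr mulmxDl -mulmxE mulmxA.
by rewrite st ?IH // add0r mul_mx_scalar -scalemxAl uL scaler0.
Qed.

(* A vector not killed by p^k and a family of functionals separating its
   socle cut the space into the cyclic subspace and the common kernel. *)
Lemma cyclic_split n d (A : 'M[F]_n.+1) p k v (L : 'M[F]_(n.+1, d.+1)) :
    primary_data A p k -> size (p ^+ k.+1) = d.+2 ->
    (forall u : 'rV[F]_n.+1, u *m L = 0 -> u *m A *m L = 0) ->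
    v *m horner_mx A (p ^+ k) *m L != 0 ->
  exists (C : 'M[F]_d.+1) (A2 : 'M[F]_(\rank (kermx L))),
    [/\ shift_mx C, horner_mx C (p ^+ k.+1) = 0,
        (d.+1 + \rank (kermx L))%N = n.+1,
        row_free (col_mx (krylov d.+1 A v) (row_base (kermx L)))
      & krylov d.+1 A v *m A = C *m krylov d.+1 A v /\
        row_base (kermx L) *m A = A2 *m row_base (kermx L)].
Proof.
move=> pd sa st vL; set K := krylov _ _ _; set a := p ^+ k.+1 in sa *.
have [ip pm pA pA'] := pd; have am : a \is monic by apply: monic_exp.
(* If r(A) were nonzero, some multiple of it would be p^k(A), and stability of the kernel of [L]
   would put v p^k(A) into that kernel. *)
have inj r : v *m horner_mx A r *m L = 0 -> horner_mx A r = 0.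
  move=> vr0; apply/eqP; apply: contraNT vL => r0.
  have [c <-] := primary_divides pd r0.
  by rewrite rmorphM /= -mulmxE mulmxA; apply/eqP/stable_horner.
have KLfree (x : 'rV_d.+1) : x *m K *m L = 0 -> x = 0.
  rewrite mul_krylov => /inj/(primary_annihilator pd) ax.
  apply: (can_inj (@rVpolyK _ _)); rewrite linear0; apply/eqP.
  apply: contraTT ax => x0; apply: contraTN (size_poly d.+1 _ : (size (rVpoly
    x) <= _)%N).
  by move=> /(dvdp_leq x0); rewrite -/a sa -ltnNge.
have uKL : K *m L \in unitmx.
  rewrite -row_free_unit; apply: inj_row_free => x.
  by rewrite mulmxA; apply: KLfree.
have rL : \rank L = d.+1.
  apply/eqP; rewrite eqn_leq rank_leq_col -{1}(mxrank_unit uKL).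
  exact: mxrankM_maxr.
have rn : (d.+1 + \rank (kermx L))%N = n.+1.
  by rewrite mxrank_ker rL subnKC // -rL rank_leq_row.
have Kfree : row_free K.
  by apply: inj_row_free => x xK; apply: KLfree; rewrite xK mul0mx.
(* Reducing powers of X modulo [a] shows that the Krylov span is stable. *)
have /submxP[C KA] : (K *m A <= K)%MS.
  apply/row_subP => i; rewrite row_mul rowK -mulmxA mulmxE -exprSr.
  rewrite -(horner_mx_X A) -rmorphXn /= (divp_eq 'X^(i.+1) a).
  rewrite rmorphD rmorphM /= pA mulr0 add0r -(mul_poly_krylov (d := d.+1))
    ?submxMl //.
  by rewrite -ltnS -sa ltn_modp monic_neq0.
have /submxP[A2 A2E] : (row_base (kermx L) *m A <= row_base (kermx L))%MS.
  rewrite eq_row_base; apply/row_subP => i; apply/sub_kermxP.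
  rewrite row_mul st //; apply/sub_kermxP; rewrite -(eq_row_base (kermx L)).
  exact: row_sub.
exists C, A2; split=> //.
- move=> i j lti; have : row i (C *m K) = row (Ordinal lti) K.
    by rewrite -KA row_mul !rowK -mulmxA mulmxE -exprSr.
  rewrite row_mul (rowE (Ordinal lti)) => /(row_free_inj Kfree)/rowP/(_ j).
  by rewrite !mxE.
- apply: (row_free_inj Kfree); rewrite mul0mx -(horner_mx_intertwine _ KA).
  by rewrite pA mulmx0.
apply: inj_row_free => x; rewrite -[x]hsubmxK mul_row_col => xV.
have xl : lsubmx x = 0.
  have kL : row_base (kermx L) *m L = 0 by apply/sub_kermxP; rewrite eq_row_base.
  apply: KLfree; have := congr1 (mulmx^~ L) xV.
  by rewrite mul0mx mulmxDl -(mulmxA (rsubmx x)) kL mulmx0 addr0.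
move: xV; rewrite xl mul0mx add0r => /eqP.
by rewrite mulmx_free_eq0 ?row_base_free // => /eqP->; rewrite row_mx0.
Qed.

Lemma conj_trivial_col K n m1 m2 (P1 : pred 'M[F]_m1) (P2 : pred 'M[F]_m2)
    (P : pred 'M[F]_n) (V1 : 'M[F]_(m1, n)) (V2 : 'M[F]_(m2, n)) A A1 A2 :
    (m1 + m2)%N = n -> row_free (col_mx V1 V2) ->
    V1 *m A = A1 *m V1 -> V2 *m A = A2 *m V2 ->
    (forall X1 X2 X, P1 X1 -> P2 X2 -> V1 *m X = X1 *m V1 -> V2 *m X = X2 *m V2 ->
       \det X = \det X1 * \det X2 -> P X) ->
  conj_trivial K P1 A1 -> conj_trivial K P2 A2 -> conj_trivial K P A.
Proof.
move=> e; subst n; set Y := col_mx _ _; rewrite row_free_unit => uY.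
move=> V1A V2A PX t1 t2.
have YE B B1 B2 : V1 *m B = B1 *m V1 -> V2 *m B = B2 *m V2 ->
    Y *m B = block_mx B1 0 0 B2 *m Y.
  by move=> E1 E2; rewrite mul_col_mx mul_block_col !mul0mx addr0 add0r E1 E2.
pose R X := P (invmx Y *m X *m Y).
apply: (conj_trivial_similar (P := R) (A := block_mx A1 0 0 A2) uY) => //.
  by rewrite (YE _ _ _ V1A V2A).
apply: conj_trivial_block t1 t2 => X1 X2 PX1 PX2.
pose X := invmx Y *m block_mx X1 0 0 X2 *m Y.
have /eqP : Y *m X = block_mx X1 0 0 X2 *m Y by rewrite /X !mulmxA mulmxV // mul1mx.
rewrite mul_col_mx mul_block_col !mul0mx addr0 add0r => /eqP/eq_col_mx[E1 E2].
apply: (PX X1 X2) => //.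
by rewrite !det_mulmx det_ublock mulrAC -det_mulmx mulVmx // det1 mul1r.
Qed.
End Krylov.

(** * Invertible matrices: reduction to the cyclic case *)

Section GeneralLinear.
Variable F : finFieldType.

Lemma restrict_unitmx m n (V : 'M[F]_(m, n)) A B :
  row_free V -> V *m A = B *m V -> A \in unitmx -> B \in unitmx.
Proof.
move=> fV VA uA; rewrite -row_free_unit; apply: inj_row_free => x xB.
apply: (row_free_inj fV); rewrite mul0mx -[LHS](mulmxK uA).
by rewrite -(mulmxA x) VA mulmxA xB !mul0mx.
Qed.

Lemma row_base_stable n (E A : 'M[F]_n) : comm_mx E A ->
  exists B, row_base E *m A = B *m row_base E.
Proof.
move=> EA; have /submxP[B ->] : (row_base E *m A <= row_base E)%MS; last by
  exists B.
rewrite eq_row_base (eqmxMr A (eq_row_base E)) EA.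
exact: submxMl.
Qed.

Lemma row_base_idem n (E : 'M[F]_n) : E *m E = E -> row_base E *m E = row_base E.
Proof.
move=> EE; have /submxP[D ->] : (row_base E <= E)%MS by rewrite eq_row_base.
by rewrite -mulmxA EE.
Qed.

Lemma idem_compl n (E : 'M[F]_n) :
  E *m E = E -> (1%:M - E) *m (1%:M - E) = 1%:M - E.
Proof.
by move=> EE; rewrite mulmxBl mul1mx mulmxBr mulmx1 EE subrr subr0.
Qed.

Lemma idempotent_split n (E : 'M[F]_n) : E *m E = E ->
  (\rank E + \rank (1%:M - E)%R)%N = n /\
  row_free (col_mx (row_base E) (row_base (1%:M - E))).
Proof.
move=> EE; have EE' : (1%:M - E) *m E = 0 by rewrite mulmxBl mul1mx EE subrr.
split.
  suff -> : \rank (1%:M - E) = \rank (kermx E).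
    by rewrite mxrank_ker subnKC // rank_leq_row.
  apply/eqmx_rank/andP; split; first exact/sub_kermxP.
  have e1 : 1%:M - E + E = 1%:M :> 'M[F]_n by rewrite subrK.
  rewrite -{1}(mulmx1 (kermx E)) -{1}e1.
  by rewrite mulmxDr mulmx_ker addr0 submxMl.
have V2E : row_base (1%:M - E) *m E = 0.
  by rewrite -(row_base_idem (idem_compl EE)) -mulmxA EE' mulmx0.
apply: inj_row_free => x; rewrite -[x]hsubmxK mul_row_col => xV.
have xl : lsubmx x = 0.
  apply: (row_free_inj (row_base_free E)); have := congr1 (mulmx^~ E) xV.
  rewrite !mul0mx mulmxDl -(mulmxA (lsubmx x)) -(mulmxA (rsubmx x)).
  by rewrite V2E mulmx0 addr0 (row_base_idem EE).
move: xV; rewrite xl mul0mx add0r => /eqP.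
by rewrite mulmx_free_eq0 ?row_base_free // => /eqP->; rewrite row_mx0.
Qed.

Lemma idempotent_rank_lt n (E : 'M[F]_n) :
  E *m E = E -> E != 1%:M -> (\rank E < n)%N.
Proof.
move=> EE; rewrite ltn_neqAle rank_leq_row andbT; apply: contraNneq => rE.
have uE : E \in unitmx by rewrite -row_free_unit /row_free rE.
by rewrite -[E](mulKmx uE) EE mulVmx.
Qed.

Lemma row_free_col_mxl m1 m2 n (U : 'M[F]_(m1, n)) (V : 'M[F]_(m2, n)) :
  row_free (col_mx U V) -> row_free U.
Proof.
move=> fUV; apply: inj_row_free => x xU.
have /eqP : row_mx x (0 : 'rV_m2) *m col_mx U V = 0.
  by rewrite mul_row_col xU mul0mx addr0.
by rewrite mulmx_free_eq0 // row_mx_eq0 => /andP[/eqP].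
Qed.

Lemma primary_size n (A : 'M[F]_n.+1) (p : {poly F}) k :
  primary_data A p k -> exists d, size (p ^+ k.+1) = d.+2.
Proof.
move=> [[sp _] pm _ _]; exists (size (p ^+ k.+1)).-2.
have := size_exp p k.+1; case: (size p) sp => [|[|s]] //= _.
by case: (size _) => [|[|t]].
Qed.

Lemma mx_neq0_row m n (M : 'M[F]_(m, n)) : M != 0 -> exists v : 'rV[F]_m, v *m
  M != 0.
Proof.
by case/rowV0Pn=> x /submxP[y ->] nz; exists y.
Qed.

Lemma krylov_mod n d (A : 'M[F]_n.+1) (p : {poly F}) k u (r : {poly F}) :
    size (p ^+ k.+1) = d.+2 -> primary_data A p k ->
  u *m horner_mx A r = poly_rV (r %% p ^+ k.+1) *m krylov d.+1 A u.
Proof.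
move=> sp [_ pm pA _]; rewrite mul_poly_krylov.
  by rewrite {1}(divp_eq r (p ^+ k.+1)) rmorphD rmorphM /= pA mulr0 add0r.
by rewrite -ltnS -sp ltn_modp monic_neq0 ?monic_exp.
Qed.

(** Induction on the size. A nontrivial idempotent commuting with [A] splits the space. Without one
    F[A] is local, and a suitable cyclic subspace has an invariant complement, cut out by the orbit
    of a functional. *)
Lemma conj_trivial_GL K :
    (forall n (C : 'M[F]_n), shift_mx C -> C \in unitmx ->
       conj_trivial K (@unimodular F n) C) ->
  forall n (A : 'M[F]_n), A \in unitmx -> conj_trivial K (@unimodular F n) A.
Proof.
move=> cyc n A; have [m] := ubnP n; elim: m n A => // m IH [|n] A nm uA.
  by apply: cyc => // -[].
have glue m1 m2 (V1 : 'M[F]_(m1, n.+1)) (V2 : 'M[F]_(m2, n.+1)) A1 A2 :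
    (m1 + m2)%N = n.+1 -> row_free (col_mx V1 V2) ->
    V1 *m A = A1 *m V1 -> V2 *m A = A2 *m V2 ->
    conj_trivial K (@unimodular F m1) A1 -> conj_trivial K (@unimodular F m2) A2 ->
    conj_trivial K (@unimodular F n.+1) A.
  move=> e fV VA1 VA2; apply: conj_trivial_col VA1 VA2 _ => // X1 X2 X.
  by rewrite /unimodular => /eqP d1 /eqP d2 _ _ ->; rewrite d1 d2 mulr1.
have [/existsP[E /and4P[/eqP EA /eqP EE E0 E1]]|noE] := boolP [exists E :
  'M[F]_n.+1,
    [&& E *m A == A *m E, E *m E == E, E != 0 & E != 1%:M]].
  have [rE fE] := idempotent_split EE.
  have [A1 A1E] := row_base_stable EA.
  have [A2 A2E] : exists B, row_base (1%:M - E) *m A = B *m row_base (1%:M - E).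
    by apply: row_base_stable; rewrite /comm_mx mulmxBl mulmxBr mul1mx mulmx1 EA.
  apply: (glue _ _ _ _ A1 A2 rE fE A1E A2E); apply: IH.
  - exact: leq_trans (idempotent_rank_lt EE E1) _.
  - exact: restrict_unitmx (row_base_free _) A1E uA.
  - apply: leq_trans (idempotent_rank_lt (idem_compl EE) _) _ => //.
    by rewrite -subr_eq0 addrAC subrr add0r oppr_eq0.
  exact: restrict_unitmx (row_base_free _) A2E uA.
have lA : local_mx A.
  move=> q E EE; case: (eqVneq E 0) => [|E0]; first by left.
  case: (eqVneq E 1%:M) => [|E1]; first by right.
  case/existsP: noE; exists E; rewrite E0 E1 EE eqxx !andbT /=.
  by apply/eqP; apply: comm_horner_mx.
have [p [k pd]] := local_mx_primary lA; have [_ _ _ pA'] := pd.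
have [d sp] := primary_size pd.
have [v vp] := mx_neq0_row pA'.
have [w vw] : exists w : 'cV[F]_n.+1, v *m horner_mx A (p ^+ k) *m w != 0.
  move: vp; rewrite -trmx_eq0 => /mx_neq0_row[x].
  by rewrite -trmx_eq0 trmx_mul trmxK => xv; exists x^T.
(* The columns are the translates A^j w of a functional [w]. The minimal polynomial has degree d+1,
   so they span the whole orbit of [w] and the kernel of [L] is stable. *)
pose L := \matrix_(i < n.+1, j < d.+1) (A ^+ j *m w) i 0.
have LE (u : 'rV[F]_n.+1) : u *m L = (krylov d.+1 A u *m w)^T.
  apply/rowP => j; rewrite !mxE.
  transitivity ((u *m (A ^+ j *m w)) 0 0).
    by rewrite mxE; apply: eq_bigr => i _; rewrite mxE.
  rewrite mulmxA mxE; apply: eq_bigr => i _; by rewrite [krylov _ _ _ _ _]mxE.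
have L0 (u : 'rV[F]_n.+1) : u *m L = 0 -> forall r, u *m horner_mx A r *m w = 0.
  rewrite LE => /(canRL (@trmxK _ _ _)); rewrite trmx0 => uw r.
  by rewrite (krylov_mod _ _ sp pd) -mulmxA uw mulmx0.
have [||C [A2 [sC pC e fV [KA VA]]]] := cyclic_split (L := L) (v := v) pd sp.
- move=> u /L0 uL; rewrite LE (_ : _ *m w = 0) ?trmx0 //.
  apply/row_matrixP => i; rewrite row_mul rowK row0 -(mulmxA u) mulmxE.
  by have := uL ('X * 'X^i); rewrite rmorphM rmorphXn /= horner_mx_X.
- apply: contra vw => /eqP/L0/(_ 1); rewrite rmorph1 mulmx1 => ->; exact: eqxx.
apply: (glue _ _ _ _ _ _ e fV KA VA).
  apply: cyc => //; apply: (restrict_unitmx _ KA uA).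
  exact: row_free_col_mxl fV.
apply: IH; last exact: restrict_unitmx (row_base_free _) VA uA.
apply: (@leq_trans (d.+1 + \rank (kermx L))); last by rewrite e.
by rewrite addSn ltnS leq_addl.
Qed.
End GeneralLinear.

(** * Hermitian forms over the field of order 4 *)

Section Unitary.
Variables (F : finFieldType) (theta : {rmorphism F -> F}).
Hypotheses (oF : #|F| = 4) (thetaE : forall x, theta x = x ^+ 2).

Lemma thetaK : involutive theta.
Proof. by move=> x; rewrite !thetaE -exprM -[RHS]expf_card oF. Qed.

Lemma addxx2 (V : lmodType F) (x : V) : x + x = 0.
Proof. by rewrite -[x]scale1r -scalerDl -mulr2n (pcharf0 (pchar_F4 oF))
  scale0r. Qed.

(** Such an element is a primitive cube root of unity, a root of X^2 + X + 1. *)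
Lemma exists_omega : exists w : F, w + theta w = 1 /\ w * theta w = 1.
Proof.
have /subsetPn[w _ w01] : ~~ ([set: F] \subset [set 0; 1]).
  by apply/negP=> /subset_leq_card; rewrite cardsT oF cards2; case: (_ == _).
have {}w01 : (w != 0) && (w != 1) by rewrite -negb_or -!in_set1 -in_setU.
have /andP[w0 w1] := w01; have w3 : w ^+ 3 = 1.
  by apply: (mulIf w0); rewrite -exprSr mul1r -[X in _ ^+ X]oF expf_card.
exists w; rewrite thetaE -exprS w3; split=> //.
have w1' : w - 1 != 0 by rewrite subr_eq0.
apply/eqP; rewrite -subr_eq0; apply/eqP; apply: (mulfI w1'); rewrite mulr0.
have -> : (w - 1) * (w + w ^+ 2 - 1) = w ^+ 3 - 1 - (w - 1 + (w - 1)) by ring.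
by rewrite w3 subrr (addxx2 (w - 1 : F^o)) subr0.
Qed.

Definition adj m n (M : 'M[F]_(m, n)) : 'M[F]_(n, m) := map_mx theta M^T.

Lemma adjE m n (M : 'M[F]_(m, n)) i j : adj M i j = theta (M j i).
Proof. by rewrite !mxE. Qed.

Lemma adjK m n (M : 'M[F]_(m, n)) : adj (adj M) = M.
Proof. by apply/matrixP=> i j; rewrite !adjE thetaK. Qed.

Lemma adjM m n l (M : 'M[F]_(m, n)) (N : 'M[F]_(n, l)) :
  adj (M *m N) = adj N *m adj M.
Proof. by rewrite /adj trmx_mul map_mxM. Qed.

Lemma adjD m n (M N : 'M[F]_(m, n)) : adj (M + N) = adj M + adj N.
Proof. by rewrite /adj linearD /= map_mxD. Qed.

Lemma adjB m n (M N : 'M[F]_(m, n)) : adj (M - N) = adj M - adj N.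
Proof. by rewrite /adj linearB /= map_mxB. Qed.

Lemma adjZ m n a (M : 'M[F]_(m, n)) : adj (a *: M) = theta a *: adj M.
Proof. by rewrite /adj linearZ /= map_mxZ. Qed.

Lemma adj0 m n : adj (0 : 'M[F]_(m, n)) = 0.
Proof. by rewrite /adj trmx0 map_mx0. Qed.

Lemma adj1 n : adj (1%:M : 'M[F]_n) = 1%:M.
Proof. by rewrite /adj trmx1 map_mx1. Qed.

Lemma adj_unit n (M : 'M[F]_n) : (adj M \in unitmx) = (M \in unitmx).
Proof. by rewrite /adj map_unitmx unitmx_tr. Qed.

Lemma adj_inv n (M : 'M[F]_n) : adj (invmx M) = invmx (adj M).
Proof. by rewrite /adj trmx_inv map_invmx. Qed.

Lemma adj_expr n (M : 'M[F]_n) k : adj (M ^+ k) = adj M ^+ k.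
Proof.
elim: k => [|k IH]; first by rewrite !expr0 adj1.
by rewrite exprS exprSr -!mulmxE adjM IH.
Qed.

(** * Norms and congruence of hermitian forms *)

Lemma unitmx_expr_order n (A : 'M[F]_n) :
  A \in unitmx -> exists2 e, (0 < e)%N & A ^+ e = 1%:M.
Proof.
case: n A => [|n] A uA; first by exists 1 => //; apply/matrixP=> -[].
have [e e0 ee] := idempotent_power A; exists e => //.
have ue : A ^+ e \in unitmx by apply: unitrX.
by rewrite -[LHS](mulKmx ue) mulmxE ee -mulmxE mulVmx.
Qed.

(** The double centralizer of [s] stands in for the polynomials in [s]: it is commutative, closed
    under ring operations and inverses, and commutes with all that commutes with [s]. *)
Definition bicomm n (s t : 'M[F]_n) :=
  forall A, A *m s = s *m A -> A *m t = t *m A.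

Section Bicommutant.
Variables (n : nat) (s : 'M[F]_n).

Lemma bicomm_self : bicomm s s. Proof. by []. Qed.

Lemma bicomm1 : bicomm s 1%:M. Proof. by move=> A _; rewrite mulmx1 mul1mx. Qed.

Lemma bicommM t u : bicomm s t -> bicomm s u -> bicomm s (t *m u).
Proof. by move=> ct cu A cA; rewrite mulmxA ct // -mulmxA cu // mulmxA. Qed.

Lemma bicommD t u : bicomm s t -> bicomm s u -> bicomm s (t + u).
Proof. by move=> ct cu A cA; rewrite mulmxDr mulmxDl ct // cu. Qed.

Lemma bicommZ a t : bicomm s t -> bicomm s (a *: t).
Proof. by move=> ct A cA; rewrite -scalemxAr -scalemxAl ct. Qed.

Lemma bicommX t k : bicomm s t -> bicomm s (t ^+ k).
Proof.
move=> ct; elim: k => [|k IH]; first exact: bicomm1.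
by rewrite exprS; apply: bicommM.
Qed.

Lemma bicommV t : bicomm s t -> bicomm s (invmx t).
Proof.
move=> ct A cA; case: (boolP (t \in unitmx)) => [ut|nt].
  rewrite -[LHS](mulKmx ut) [t *m _]mulmxA -(ct _ cA) -!mulmxA mulmxV //.
  by rewrite mulmx1.
by rewrite /invmx (negPf nt); apply: ct.
Qed.

Lemma bicomm_comm t u : bicomm s t -> bicomm s u -> t *m u = u *m t.
Proof. by move=> ct cu; apply: (cu t); apply/esym/ct. Qed.
End Bicommutant.

Lemma comm_nilpotent_unit n (y : 'M[F]_n) e : y ^+ e = 0 -> 1%:M + y \in unitmx.
Proof.
move=> ye; have : (1%:M + y) *m (\sum_(i < e) (- y) ^+ i) = 1%:M.
  have := subrX1 (- y) e; rewrite exprNn ye mulr0 sub0r => /esym.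
  by rewrite -opprD mulNr => /oppr_inj; rewrite addrC.
by case/mulmx1_unit.
Qed.

(* With w + w^2 = w^3 = 1 one has (1 + w y) (1 + w^2 y) = 1 + y + y^2, which
   differs from 1 + y by a factor 1 + y' with y' divisible by y^2. *)
Lemma exists_unipotent_norm n (H s y : 'M[F]_n) e :
    bicomm s y -> y *m H = H *m adj y -> y ^+ e.+1 = 0 ->
  exists2 t, bicomm s t & t *m H *m adj t = (1%:M + y) *m H.
Proof.
have [w [w1 w2]] := exists_omega.
elim: e y => [|e IH] y cy yH ye.
  exists 1%:M; first exact: bicomm1.
  have -> : y = 0 by rewrite -ye expr1.
  by rewrite adj1 addr0 mulmx1.
pose z := 1%:M + (y + y *m y).
have cz : bicomm s z by do! [apply: bicomm1 | apply: bicommD | apply: bicommM].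
have uz : z \in unitmx.
  apply: (@comm_nilpotent_unit _ _ e.+2).
  have -> : y + y *m y = y * (1%:M + y) by rewrite mulrDr mulr1.
  rewrite exprMn_comm ?ye ?mul0r //.
  by apply: (bicomm_comm cy); apply: bicommD => //; apply: bicomm1.
have zH : z *m H = H *m adj z.
  rewrite /z !adjD adj1 adjM !mulmxDr !mulmxDl mul1mx mulmx1 yH.
  by rewrite -mulmxA yH !mulmxA -yH.
have zVH : invmx z *m H = H *m adj (invmx z).
  apply: (canLR (mulKmx uz)); rewrite mulmxA zH -mulmxA -adjM.
  by rewrite (bicomm_comm (bicommV cz) cz) mulmxV // adj1 mulmx1.
(* In characteristic 2, (1 + y') z = z + y^2 = 1 + y, and y' is nilpotent with a smaller
   exponent. *)
pose y' := y *m y *m invmx z.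
have cy' : bicomm s y' by do! apply: bicommM => //; apply: bicommV.
have y'H : y' *m H = H *m adj y'.
  have e1 : y *m y *m invmx z = invmx z *m (y *m y).
    by apply: (bicomm_comm (bicommM cy cy)); apply: bicommV.
  rewrite {2}/y' e1 !adjM /y' -(mulmxA _ _ H) zVH (mulmxA _ H) -(mulmxA y y) yH.
  by rewrite (mulmxA y) yH !mulmxA.
have y'e : y' ^+ e.+1 = 0.
  rewrite /y' -(mulmxA y) exprMn_comm; last first.
    by apply: (bicomm_comm cy); apply: bicommM => //; apply: bicommV.
  rewrite exprMn_comm; last by apply: (bicomm_comm cy); apply: bicommV.
  by rewrite mulrA -exprD addSnnS addnC exprD ye !mul0r.
have [t' ct' t'H] := IH y' cy' y'H y'e.
exists ((1%:M + w *: y) *m t').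
  by apply: bicommM => //; apply: bicommD; [apply: bicomm1 | apply: bicommZ].
have ct : bicomm s (1%:M + w *: y).
  by apply: bicommD; [apply: bicomm1 | apply: bicommZ].
have yy : (1%:M + w *: y) *m (1%:M + theta w *: y) = z.
  rewrite mulmxDl mul1mx mulmxDr mulmx1 -scalemxAl -scalemxAr scalerA w2 scale1r.
  by rewrite /z -!addrA; congr (_ + _); rewrite addrCA addrA -scalerDl w1 scale1r.
have Hadj : H *m adj (1%:M + w *: y) = (1%:M + theta w *: y) *m H.
  by rewrite adjD adj1 adjZ mulmxDr mulmxDl mulmx1 mul1mx -scalemxAr -scalemxAl yH.
have -> : (1%:M + w *: y) *m t' *m H *m adj ((1%:M + w *: y) *m t') =
          (1%:M + w *: y) *m (t' *m H *m adj t') *m adj (1%:M + w *: y).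
  by rewrite adjM !mulmxA.
rewrite t'H -!mulmxA Hadj !mulmxA; congr (_ *m H).
rewrite (bicomm_comm ct (bicommD (@bicomm1 n s) cy')) -mulmxA yy.
rewrite mulmxDl mul1mx /y' mulmxKV // /z -!addrA; congr (_ + _).
by rewrite addxx2 addr0.
Qed.

Lemma odd_part_power e : (0 < e)%N -> exists a o, e = (2 ^ a * o)%N /\ odd o.
Proof.
move=> e0; exists (logn 2 e), (e`_2^')%N.
by rewrite -p_part partnC // odd_2'nat part_pnat.
Qed.

Lemma expr2X_addr1 n (z : 'M[F]_n) a : (z - 1) ^+ (2 ^ a) = z ^+ (2 ^ a) - 1.
Proof.
elim: a => [|a IH]; first by rewrite !expr1.
have N (x : 'M[F]_n) : - x = x by rewrite -[LHS]addr0 -(addxx2 x) addKr.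
rewrite expnSr !exprM IH expr2 !N mulrDl mul1r mulrDr mulr1 -expr2 addrA.
by rewrite -(addrA (_ ^+ 2)) addxx2 addr0.
Qed.

(* If s has order 2^a * o with o odd, then s is a square times s ^+ o, and
   s ^+ o is unipotent. *)
Lemma herm_norm n (H s : 'M[F]_n) :
    s \in unitmx -> s *m H = H *m adj s ->
  exists2 t, bicomm s t & t *m H *m adj t = s *m H.
Proof.
move=> us sH; have [e e0 se] := unitmx_expr_order us.
have [a [o [eE oo]]] := odd_part_power e0.
have sHX k : s ^+ k *m H = H *m adj (s ^+ k).
  rewrite adj_expr; elim: k => [|k IH]; first by rewrite !expr0 mulmx1 mul1mx.
  by rewrite !exprS -!mulmxE -mulmxA IH mulmxA sH -!mulmxA.
have oe : (o <= e)%N by rewrite eE leq_pmull // expn_gt0.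
have cs k : bicomm s (s ^+ k) by apply/bicommX/bicomm_self.
have [||| t ct tH] := @exists_unipotent_norm n H s (s ^+ o - 1%:M) (2 ^ a).-1.
- by apply: bicommD => //; rewrite -scaleN1r; apply/bicommZ/bicomm1.
- by rewrite adjB adj1 mulmxBl mulmxBr sHX mulmx1 mul1mx.
- by rewrite prednK ?expn_gt0 // expr2X_addr1 -exprM mulnC -eE se subrr.
exists (s ^+ (e - o./2) *m t); first by apply: bicommM.
rewrite adjM; have -> : s ^+ (e - o./2) *m t *m H *m (adj t *m adj (s ^+ (e -
  o./2))) =
  s ^+ (e - o./2) *m (t *m H *m adj t) *m adj (s ^+ (e - o./2)) by rewrite !mulmxA.
rewrite tH addrC subrK -!mulmxA -sHX !mulmxA !mulmxE -!exprD; congr (_ * H).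
(* Since [o] is odd, the exponents add up to 2e + 1, and s^(2e+1) = s. *)
have -> : (e - o./2 + o + (e - o./2) = e + e + 1)%N.
  by have := odd_double_half o; rewrite oo -addnn; lia.
by rewrite !exprD se !mul1r expr1.
Qed.

(** The matrix s = H' H^-1 is self-adjoint for [H], so the norm lemma gives [t] in the double
    centralizer of s. A common isometry of both forms commutes with s, hence with [t]. *)
Lemma herm_congruent n (H H' : 'M[F]_n) :
    H \in unitmx -> H' \in unitmx -> adj H = H -> adj H' = H' ->
  exists t, [/\ t \in unitmx, t *m H *m adj t = H' &
    forall A, A *m H *m adj A = H -> A *m H' *m adj A = H' -> A *m t = t *m A].
Proof.
move=> uH uH' aH aH'; pose s := H' *m invmx H.
have sHE : s *m H = H' by rewrite mulmxKV.
have us : s \in unitmx by rewrite unitmx_mul uH' unitmx_inv.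
have [|t ct tH] := herm_norm (H := H) us.
  by rewrite sHE -{1}aH -adjM sHE aH'.
rewrite sHE in tH; exists t; split=> //.
  by move: uH'; rewrite -tH !unitmx_mul => /andP[/andP[]].
move=> A AH AH'; apply: ct.
have uA : A \in unitmx by move: uH; rewrite -{1}AH !unitmx_mul => /andP[/andP[]].
apply: (row_free_inj (A := H *m adj A)).
  by rewrite row_free_unit unitmx_mul uH adj_unit.
transitivity H'; first by rewrite -mulmxA (mulmxA s) sHE mulmxA AH'.
by rewrite -mulmxA (mulmxA A) AH sHE.
Qed.

(** * Special isometries and real elements *)

Definition special_unitary n (H X : 'M[F]_n) :=
  unimodular X && (X *m H *m adj X == H).

Lemma special_unitary1 n (H : 'M[F]_n) : special_unitary H 1%:M.
Proof. by rewrite /special_unitary unimodular1 adj1 mul1mx mulmx1 eqxx. Qed.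

Lemma special_unitaryM n (H X Y : 'M[F]_n) :
  special_unitary H X -> special_unitary H Y -> special_unitary H (X *m Y).
Proof.
move=> /andP[dX /eqP XH] /andP[dY /eqP YH].
rewrite /special_unitary unimodularM //= adjM -(mulmxA X Y H).
by rewrite !mulmxA -(mulmxA X) -(mulmxA X) YH XH.
Qed.

(** Squaring is the automorphism [theta], hence injective. Determinants of matrices of 2-power order
    are therefore 1. *)
Lemma fourth_field_root1 (x : F) a : x ^+ (2 ^ a) = 1 -> x = 1.
Proof.
elim: a => [|a IH]; first by rewrite expr1.
by rewrite expnSr exprM -thetaE => /eqP; rewrite fmorph_eq1 => /eqP/IH.
Qed.

Lemma unimodular_rev n : unimodular (rev_mx F n).
Proof. by apply/eqP/(@fourth_field_root1 _ 1); rewrite det_rev_sqr. Qed.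

(* A power of X with odd exponent still inverts A and has 2-power order, hence
   determinant 1. *)
Lemma conj_trivial_real K n (H A X : 'M[F]_n) :
    X \in unitmx -> X *m H *m adj X = H -> A \in unitmx -> A *m X = X *m invmx A ->
  conj_trivial K.*2 (special_unitary H) A.
Proof.
move=> uX XH uA AX; have [e e0 Xe] := unitmx_expr_order uX.
have [a [o [eE oo]]] := odd_part_power e0.
have XHo k : X ^+ k *m H *m adj (X ^+ k) = H.
  elim: k => [|k IH]; first by rewrite expr0 adj1 mul1mx mulmx1.
  by rewrite exprS -mulmxE adjM -(mulmxA X) !mulmxA -(mulmxA X) -(mulmxA X) IH XH.
have uXo : X ^+ o \in unitmx.
  elim: o {oo eE} => [|k IH]; first by rewrite expr0 unitmx1.
  by rewrite exprS -mulmxE unitmx_mul uX.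
have AXo : A *m X ^+ o = X ^+ o *m invmx A.
  have AX2 : A *m (X *m X) = X *m X *m A.
    have AV : invmx A *m X = X *m A.
      by rewrite -{1}(mulmxKV uA X) -AX -mulmxA mulKmx.
    by rewrite mulmxA AX -mulmxA AV mulmxA.
  rewrite -(odd_double_half o) oo add1n -mul2n exprSr exprM expr2 -mulmxE.
  have AXk k : A *m (X *m X) ^+ k = (X *m X) ^+ k *m A.
    elim: k => [|k IH]; first by rewrite expr0 mulmx1 mul1mx.
    by rewrite exprS -mulmxE mulmxA AX2 -mulmxA IH mulmxA.
  by rewrite mulmxA AXk -!mulmxA AX.
have dX : unimodular (X ^+ o).
  have detX m (Z : 'M[F]_n) : \det (Z ^+ m) = \det Z ^+ m.
    by elim: m => [|m IH]; rewrite ?det1 // !exprS -IH -det_mulmx.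
  by apply/eqP/(@fourth_field_root1 _ a); rewrite -detX -exprM mulnC -eE Xe det1.
apply: (@conj_trivial_comp _ K _ _ _ (X ^+ o)) => // [Y|].
  by apply: special_unitaryM; rewrite /special_unitary dX XHo eqxx.
apply: conj_trivial_expr; first exact: special_unitary1.
by rewrite -(mulmxA (invmx _)) AXo mulKmx // mulmxV // expr1n.
Qed.

(** Conjugation by [t] carries one isometry group to the other and fixes [A]. *)
Lemma conj_trivial_congruent K n (H H' t A : 'M[F]_n) :
    t \in unitmx -> t *m H *m adj t = H' -> A *m t = t *m A ->
  conj_trivial K (special_unitary H') A -> conj_trivial K (special_unitary H) A.
Proof.
move=> ut tH At; apply: (conj_trivial_similar ut At) => X _ /andP[dX /eqP XH].
rewrite /special_unitary unimodularJ //=; apply/eqP.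
have HE : H = invmx t *m H' *m adj (invmx t).
  rewrite adj_inv -tH !mulmxA mulVmx // mul1mx mulmxK ?adj_unit //.
rewrite [RHS]HE -XH adjM adjM HE !mulmxA mulmxK // -(mulmxA _ (adj (invmx t))
  (adj t)).
rewrite -[adj (invmx t) *m adj t]adjM mulmxV // adj1 mulmx1.
by rewrite -tH.
Qed.

(** * Isometries that are companion matrices *)

Lemma shift_mx_krylov n (C : 'M[F]_n.+1) :
  shift_mx C -> krylov n.+1 C (delta_mx 0 ord0) = 1%:M.
Proof.
move=> sC; apply/row_matrixP => -[i]; elim: i => [|i IH] lti; rewrite rowK.
  by rewrite expr0 mulmx1 rowE mulmx1; congr delta_mx; apply: val_inj.
have := IH (ltnW lti); rewrite rowK exprSr -mulmxE mulmxA => ->.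
rewrite row1 -rowE; apply/rowP => j; rewrite mxE sC // !mxE.
by rewrite -val_eqE eq_sym.
Qed.

(** The first basis vector generates a Krylov basis equal to the standard one, so row i holds the
    coefficients of X^(i+1) modulo [a]. *)
Lemma shift_mx_uniq n (C C' : 'M[F]_n.+1) (a : {poly F}) :
    shift_mx C -> shift_mx C' -> a \is monic -> size a = n.+2 ->
    horner_mx C a = 0 -> horner_mx C' a = 0 -> C = C'.
Proof.
move=> sC sC' am sa.
suff rowC (D : 'M[F]_n.+1) : shift_mx D -> horner_mx D a = 0 ->
    D = \matrix_(i < n.+1) poly_rV ('X^(i.+1) %% a).
  by move=> C0 C'0; rewrite [C]rowC // [C']rowC.
move=> sD D0; apply/row_matrixP => i; rewrite rowK.
have /row_matrixP/(_ i) := shift_mx_krylov sD; rewrite rowK row1 => Di.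
rewrite rowE -Di -mulmxA mulmxE -exprSr -{1}(horner_mx_X D) -rmorphXn /=.
rewrite {1}(divp_eq 'X^(i.+1) a) rmorphD rmorphM /= D0 mulr0 add0r.
rewrite -(mul_poly_krylov (d := n.+1)) ?(shift_mx_krylov sD) ?mulmx1 //.
by rewrite -ltnS -sa ltn_modp monic_neq0.
Qed.

Lemma adj_horner n (A : 'M[F]_n.+1) q :
  adj (horner_mx A q) = horner_mx (adj A) (map_poly theta q).
Proof.
elim/poly_ind: q => [|q c IH]; first by rewrite !rmorph0 adj0.
rewrite !(rmorphD, rmorphM) /= map_polyX map_polyC /= !horner_mx_X !horner_mx_C.
rewrite adjD -mulmxE adjM IH; congr (_ + _).
  exact: comm_mx_horner.
by rewrite -scalemx1 adjZ adj1 scalemx1.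
Qed.

(** [H] intertwines [adj C] with the inverse of [C], and the adjoint applies [theta] to the
    coefficients. *)
Lemma horner_mx_inv n (H C : 'M[F]_n.+1) q : H \in unitmx ->
    C *m H *m adj C = H -> horner_mx C q = 0 ->
  horner_mx (invmx C) (map_poly theta q) = 0.
Proof.
move=> uH CH C0; have uC : C \in unitmx.
  by move: uH; rewrite -{1}CH !unitmx_mul => /andP[/andP[]].
have HC : H *m adj C = invmx C *m H by rewrite -{2}CH -!mulmxA mulKmx.
have := horner_mx_intertwine (map_poly theta q) HC.
rewrite -adj_horner C0 adj0 mulmx0 => /esym E.
by rewrite -[LHS](mulmxK uH) E mul0mx.
Qed.

(** Both C and R C^-1 R are companion matrices killed by [a], hence equal, so R inverts C. The forms
    H and R H R are both invariant under C, and a congruence between them that commutes with C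
    corrects R to an isometry. *)
Lemma conj_trivial_shift_real n (H C : 'M[F]_n.+1) (a : {poly F}) :
    H \in unitmx -> adj H = H -> C *m H *m adj C = H ->
    shift_mx C -> a \is monic -> size a = n.+2 -> horner_mx C a = 0 ->
    map_poly theta a = a ->
  conj_trivial 12 (special_unitary H) C.
Proof.
move=> uH aH CH sC am sa C0 ta; set R := rev_mx F n.+1.
have uC : C \in unitmx by move: uH; rewrite -{1}CH !unitmx_mul => /andP[/andP[]].
have uR : R \in unitmx := rev_mx_unit F _.
have aR : adj R = R.
  by apply/matrixP=> i j; rewrite adjE !mxE rmorph_nat -(inj_eq rev_ord_inj)
    rev_ordK eq_sym.
have CE : C = R *m invmx C *m R.
  apply: (shift_mx_uniq sC _ am sa C0).
    move=> i j lti; rewrite rev_mxMr rev_mxMl; pose i' := Ordinal lti.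
    have li' : rev_ord i = (rev_ord i').+1 :> nat by rewrite /= subnSK // -ltnS.
    rewrite -(shift_mulmx (invmx C) (rev_ord j) sC li') mulmxV // mxE.
    by rewrite (inj_eq rev_ord_inj) eq_sym.
  have := horner_mx_inv uH CH C0; rewrite ta => iC0.
  have E : R *m (R *m invmx C *m R) = invmx C *m R by rewrite !mulmxA rev_mxK
    mul1mx.
  have := horner_mx_intertwine a E; rewrite iC0 mul0mx => /(congr1 (mulmx R)).
  by rewrite mulmxA rev_mxK mul1mx mulmx0.
have CR : C *m R = R *m invmx C by rewrite {1}CE -mulmxA rev_mxK mulmx1.
have uH' : R *m H *m R \in unitmx by rewrite !unitmx_mul uR uH.
have [|t [ut tH tC]] := herm_congruent uH uH' aH.
  by rewrite !adjM aR aH !mulmxA.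
have Ct : C *m t = t *m C.
  have iH : invmx C *m H *m adj (invmx C) = H.
    rewrite -{1}CH adj_inv !mulmxA mulVmx // mul1mx mulmxK ?adj_unit //.
  have RC : R *m adj C = adj (invmx C) *m R by rewrite -{1}aR -adjM CR adjM aR.
  apply: tC => //; rewrite !mulmxA CR -(mulmxA _ R (adj C)) RC.
  by rewrite -{2}iH !mulmxA.
(* Two conjugates of [C] already have product 1; the value 6 pads the relation to the common length
   12. *)
apply: (@conj_trivial_real 6 _ _ _ (invmx t *m R)) => //.
- by rewrite unitmx_mul unitmx_inv ut.
- rewrite adjM aR adj_inv !mulmxA -(mulmxA _ R H) -(mulmxA _ _ R) -tH.
  by rewrite !mulmxA mulVmx // mul1mx mulmxK ?adj_unit.
have Cti : C *m invmx t = invmx t *m C.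
  by rewrite -[LHS](mulKmx ut) [t *m _]mulmxA -Ct -!mulmxA mulmxV // mulmx1.
by rewrite mulmxA Cti -mulmxA CR mulmxA.
Qed.

(** * Invariant Toeplitz forms *)

Definition toeplitz n (M : 'M[F]_n) := forall i i' j j' : 'I_n,
  i' = i.+1 :> nat -> j' = j.+1 :> nat -> M i' j' = M i j.

Lemma toeplitz_shift n (M : 'M[F]_n) k (i i' j j' : 'I_n) : toeplitz M ->
  i' = (i + k)%N :> nat -> j' = (j + k)%N :> nat -> M i' j' = M i j.
Proof.
move=> tM; elim: k i' j' => [|k IH] i' j'; rewrite ?addn0 ?addnS => ei ej.
  by congr (M _ _); apply: val_inj.
have li : (i + k < n)%N by rewrite ltnW // -ei ltn_ord.
have lj : (j + k < n)%N by rewrite ltnW // -ej ltn_ord.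
by rewrite (tM (Ordinal li) _ (Ordinal lj)) //; apply: IH.
Qed.

(** [C] sends each basis vector to the next, so invariance equates the form on consecutive pairs of
    basis vectors. *)
Lemma isometry_toeplitz n (C M : 'M[F]_n) :
  shift_mx C -> C *m M *m adj C = M -> toeplitz M.
Proof.
move=> sC CM i i' j j' ei ej.
rewrite -[in RHS]CM -mulmxA (shift_mulmx _ _ sC ei) -[M in RHS]adjK -adjM adjE.
by rewrite (shift_mulmx _ _ sC ej) adjE thetaK.
Qed.

Lemma toeplitz_symmetric n (M : 'M[F]_n.+1) : toeplitz M ->
  (forall j, M ord0 j = M j ord0) -> M^T = M.
Proof.
move=> tM M0; apply/matrixP => i j; rewrite mxE.
wlog ij : i j / (i <= j)%N => [W|].
  by have [/W//|/ltnW/W] := leqP i j.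
have lk : (j - i < n.+1)%N by apply: leq_ltn_trans (leq_subr _ _) (ltn_ord j).
rewrite (toeplitz_shift (k := i) (i := Ordinal lk) (j := ord0)) //=; last by
  rewrite subnK.
rewrite -M0; apply/esym/(toeplitz_shift (k := i)) => //=.
by rewrite subnK.
Qed.

(** Reversing both indices of a Toeplitz matrix transposes it. *)
Lemma toeplitz_rev n (M : 'M[F]_n) : toeplitz M -> M^T = M ->
  rev_mx F n *m M *m rev_mx F n = M.
Proof.
move=> tM sM; apply/matrixP => i j; rewrite rev_mxMr rev_mxMl.
wlog ij : i j / (i <= j)%N => [W|].
  have [/W//|/ltnW/W] := leqP i j.
  by rewrite -{1 2}sM !mxE.
rewrite -{1}sM mxE; apply: esym.
have [kl|kl] := leqP i (rev_ord j).
  apply: esym; apply: (toeplitz_shift (k := (rev_ord j - i)%N)) => //=.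
    by rewrite subnKC.
  by have /= := ltn_ord j; have /= := ltn_ord i; move: kl => /=; lia.
apply: (toeplitz_shift (k := (i - rev_ord j)%N)) => //=.
  by rewrite subnKC // ltnW.
by have /= := ltn_ord j; have /= := ltn_ord i; move: kl => /=; lia.
Qed.

(* The n equations expressing that the form q(C) H is a symmetric matrix have a
   nonzero solution q among the n + 1 coefficients. *)
Lemma exists_real_form n (H C : 'M[F]_n.+1) :
    H \in unitmx -> C *m H *m adj C = H -> shift_mx C ->
  exists N, [/\ N != 0, C *m N *m adj C = N, N^T = N & map_mx theta N = N].
Proof.
move=> uH CH sC.
pose e (i : 'I_n.+1) : 'rV[F]_n.+1 := delta_mx 0 i.
(* By the Toeplitz property it suffices to equate the first row with the first column, which gives n
   conditions. *)
pose G := \matrix_(k < n.+1, j < n)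
  ((krylov n.+1 C (e ord0) *m H) k (lift ord0 j)
   - (krylov n.+1 C (e (lift ord0 j)) *m H) k ord0).
have /rowV0Pn[x /sub_kermxP xG x0] : kermx G != 0.
  rewrite kermx_eq0 /row_free neq_ltn.
  by rewrite (leq_ltn_trans (rank_leq_col G)).
pose M := horner_mx C (rVpoly x) *m H.
have ME i j : M i j = (x *m (krylov n.+1 C (e i) *m H)) 0 j.
  by rewrite mulmxA mul_krylov -mulmxA /e -rowE [RHS]mxE.
have MC : C *m M *m adj C = M.
  rewrite /M mulmxA (comm_mx_horner _ (comm_mx_refl C)) -!mulmxA.
  by rewrite (mulmxA C) CH.
have M0 : M != 0.
  apply: contra x0 => /eqP M0; have : row ord0 M = 0 by rewrite M0 row0.
  rewrite /M row_mul rowE -mul_krylov (shift_mx_krylov sC) mulmx1.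
  by move=> xH; rewrite -[x](mulmxK uH) xH mul0mx.
have tM := isometry_toeplitz sC MC.
have symM : M^T = M.
  apply: toeplitz_symmetric => // j; have [j' ->|->//] := unliftP ord0 j.
  apply/eqP; rewrite -subr_eq0 !ME; apply/eqP.
  transitivity ((x *m G) 0 j'); last by rewrite xG mxE.
  rewrite [RHS]mxE [X in X - _]mxE [X in _ - X]mxE -sumrB.
  by apply: eq_bigr => k _; rewrite -mulrBr [G _ _]mxE.
have adjM' : map_mx theta M = adj M by rewrite /adj symM.
(* Here N is the entrywise trace of [c *: M] to the prime field. *)
have real c : let N := c *: M + theta c *: map_mx theta M in
    [/\ C *m N *m adj C = N, N^T = N & map_mx theta N = N].
  split.
  - have CaM : C *m adj M *m adj C = adj M
      by rewrite -[in RHS]MC !adjM adjK !mulmxA.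
    by rewrite mulmxDr mulmxDl -!scalemxAr -!scalemxAl MC adjM' CaM.

  - have tM' : (map_mx theta M)^T = map_mx theta M by rewrite map_trmx symM.
    by rewrite linearD !linearZ /= symM tM'.
  rewrite map_mxD !map_mxZ thetaK addrC; congr (_ + _ *: _).
  by apply/matrixP=> i j; rewrite !mxE thetaK.
have [w [w1 w2]] := exists_omega.
(* If the trace of M vanishes, then [theta] fixes M, and the trace of w M is (w + theta w) M = M. *)
have [N1|N1] := eqVneq (1 *: M + theta 1 *: map_mx theta M) 0; last first.
  by exists (1 *: M + theta 1 *: map_mx theta M); have [] := real 1.
exists (w *: M + theta w *: map_mx theta M).
have [? ? ?] := real w; split=> //.
move: N1; rewrite rmorph1 !scale1r => N1.
have -> : map_mx theta M = M by rewrite -[LHS]add0r -(addxx2 M) -addrA N1 addr0.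
by rewrite -scalerDl w1 scale1r.
Qed.

(** The reversal is an isometry of an invariant symmetric form N over the prime field, so it remains
    to see that N is nondegenerate. Otherwise p^k(C) N = 0; the same then holds for the image of p^k
    under [theta], and coprimality forces N = 0. *)
Lemma conj_trivial_shift_nonreal n (H C : 'M[F]_n.+1) (p : {poly F}) k :
    H \in unitmx -> adj H = H -> C *m H *m adj C = H -> shift_mx C ->
    irreducible_poly p -> p \is monic -> size (p ^+ k.+1) = n.+2 ->
    horner_mx C (p ^+ k.+1) = 0 -> map_poly theta p != p ->
  conj_trivial 12 (special_unitary H) C.
Proof.
move=> uH aH CH sC ip pm sp C0 tp.
have [N [N0 NC sN rN]] := exists_real_form uH CH sC.
have aN : adj N = N by rewrite /adj sN.
have uC : C \in unitmx by move: uH; rewrite -{1}CH !unitmx_mul => /andP[/andP[]].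
have cop : coprimep p (map_poly theta p).
  rewrite coprimep_def; apply: contraR tp => g1.
  have gp := ip _ g1 (dvdp_gcdl _ _).
  have pp : p %| map_poly theta p by rewrite -(eqp_dvdl _ gp) dvdp_gcdr.
  have : p %= map_poly theta p by rewrite -dvdp_size_eqp // size_map_poly.
  by rewrite eqp_monic ?map_monic // eq_sym.
(* This [s] commutes with the cyclic matrix [C], so it is a polynomial in [C]. *)
pose s := N *m invmx H; have sH : s *m H = N by rewrite mulmxKV.
have Cs : C *m s = s *m C.
  apply: (row_free_inj (A := H *m adj C)).
    by rewrite row_free_unit unitmx_mul uH adj_unit.
  by rewrite -mulmxA (mulmxA s) sH mulmxA NC -mulmxA (mulmxA C) CH sH.
have kry := shift_mx_krylov sC.
pose q := rVpoly (row ord0 s).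
have row_comm (B : 'M[F]_n.+1) : C *m B = B *m C -> row ord0 B = 0 -> B = 0.
  move=> CB B0; apply/row_matrixP => i; rewrite row0.
  have /row_matrixP/(_ i) := kry; rewrite rowK row1 => ei.
  have CiB : B *m C ^+ i = C ^+ i *m B.
    have := comm_mx_horner 'X^i (esym CB : comm_mx B C).
    by rewrite rmorphXn /= horner_mx_X.
  by rewrite rowE -ei -mulmxA -CiB mulmxA -rowE B0 mul0mx.
have sE : s = horner_mx C q.
  apply/eqP; rewrite -subr_eq0; apply/eqP; apply: row_comm.
    by rewrite mulmxBr mulmxBl Cs (comm_mx_horner _ (comm_mx_refl C)).
  apply/eqP; rewrite linearB /= subr_eq0 [row ord0 (horner_mx _ _)]rowE.
  by rewrite -mul_krylov kry mulmx1.
have uN : N \in unitmx.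
  rewrite -sH unitmx_mul uH andbT.
  apply: contraNT N0 => ns.
  have pq : p %| q.
    apply: contraNT ns => npq.
    have /Bezout_eq1_coprimepP[[u v] /= uv] : coprimep (p ^+ k.+1) q.
      rewrite coprimep_pexpl // coprimep_def; apply: contraNT npq => g1.
      by rewrite -(eqp_dvdl _ (ip _ g1 (dvdp_gcdl _ _))) dvdp_gcdr.
    have : horner_mx C v *m s = 1%:M.
      rewrite sE mulmxE -rmorphM -[RHS](rmorph1 (horner_mx C)) -uv.
      by rewrite rmorphD [in RHS]rmorphM /= C0 mulr0 add0r.
    by case/mulmx1_unit.
  have pkN : horner_mx C (p ^+ k) *m N = 0.
    rewrite -sH mulmxA sE mulmxE -rmorphM.
    have [r ->] := dvdpP _ _ pq; rewrite mulrCA -exprSr rmorphM /= C0 mulr0.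
    by rewrite -mulmxE mul0mx.
  have spk : (size (p ^+ k) <= n.+1)%N.
    rewrite -ltnS -sp exprS size_mul ?expf_neq0 ?irredp_neq0 //.
    by case: (size p) (ip.1) => [|[|b]] // _; rewrite !addSn /= ltnS leq_addl.
  (* [theta] is applied to the first row only, which is the coefficient vector of p^k times N, with
     N fixed by [theta]; [row_comm] extends the vanishing to all rows. *)
  have tpkN : horner_mx C (map_poly theta (p ^+ k)) *m N = 0.
    rewrite -sH mulmxA; set B := _ *m s.
    suff -> : B = 0 by rewrite mul0mx.
    apply: row_comm.
      by rewrite /B (mulmxA C) (comm_mx_horner _ (comm_mx_refl C)) -(mulmxA _ C
        s) Cs (mulmxA _ s).
    apply: (row_free_inj (A := H)); first by rewrite row_free_unit.
    rewrite mul0mx -row_mul /B -mulmxA sH row_mul rowE.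
    rewrite -(mul_poly_krylov (d := n.+1)) ?size_map_poly // kry mulmx1.
    rewrite -map_poly_rV -rN -map_mxM /=.
    have -> : poly_rV (p ^+ k) *m N = row ord0 (horner_mx C (p ^+ k) *m N).
      by rewrite row_mul rowE -(mul_poly_krylov (d := n.+1)) // kry mulmx1.
    by rewrite pkN row0 map_mx0.
  have /Bezout_eq1_coprimepP[[u v] /= uv] : coprimep (p ^+ k) (map_poly theta
    (p ^+ k)).
    by rewrite rmorphXn /= coprimep_expl // coprimep_expr.
  rewrite -[N]mul1mx -[1%:M](rmorph1 (horner_mx C)) -uv rmorphD !rmorphM /=.
  by rewrite mulmxDl -!mulmxE -!mulmxA pkN tpkN !mulmx0 addr0.
have [t [ut tH tC]] := herm_congruent uH uN aH aN.
apply: (conj_trivial_congruent ut tH (tC C CH NC)).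
have tN := isometry_toeplitz sC NC.
apply: (@conj_trivial_rev _ 6) => [|Y|].
- exact: special_unitary1.
- apply: special_unitaryM; rewrite /special_unitary unimodular_rev /=.
  have -> : adj (rev_mx F n.+1) = rev_mx F n.+1.
    by apply/matrixP=> i j; rewrite adjE !mxE rmorph_nat -(inj_eq rev_ord_inj)
      rev_ordK eq_sym.
  by rewrite toeplitz_rev.
have := @last_row_mx_expr_char2 F n _ (pchar_F4 oF) (or_intror oF)
  (shift_rev_last_row sC).
rewrite oF addrC subrK; apply.
by rewrite !unitmx_mul uC rev_mx_unit.
Qed.

Lemma conj_trivial_GL_F4 n (A : 'M[F]_n) :
  A \in unitmx -> conj_trivial 12 (@unimodular F n) A.
Proof.
move: n A; apply: conj_trivial_GL => -[|n] C sC uC.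
  by apply: conj_trivial_expr; [apply: unimodular1 | apply/matrixP=> -[]].
apply: (@conj_trivial_rev _ 6) => [|Y|]; first exact: unimodular1.
  exact/unimodularM/unimodular_rev.
have := @last_row_mx_expr_char2 F n _ (pchar_F4 oF) (or_intror oF)
  (shift_rev_last_row sC).
rewrite oF addrC subrK; apply.
by rewrite !unitmx_mul uC rev_mx_unit.
Qed.

(** * Orthogonal and isotropic splittings *)

Lemma isometry_restrict m n (V : 'M[F]_(m, n)) (H A : 'M[F]_n) B :
  V *m A = B *m V -> A *m H *m adj A = H ->
  B *m (V *m H *m adj V) *m adj B = V *m H *m adj V.
Proof.
move=> VA AH; rewrite -[in RHS]AH !mulmxA -(mulmxA _ (adj V)) -adjM -VA adjM.
by rewrite VA !mulmxA.
Qed.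

Lemma adj_gram2 m1 m2 n (V1 : 'M[F]_(m1, n)) (V2 : 'M[F]_(m2, n)) (H : 'M[F]_n) :
  adj H = H -> adj (V1 *m H *m adj V2) = V2 *m H *m adj V1.
Proof. by move=> aH; rewrite !adjM adjK aH mulmxA. Qed.

Lemma adj_gram m n (V : 'M[F]_(m, n)) (H : 'M[F]_n) :
  adj H = H -> adj (V *m H *m adj V) = V *m H *m adj V.
Proof. exact: adj_gram2. Qed.

Lemma gram_col_mx m1 m2 n (V1 : 'M[F]_(m1, n)) (V2 : 'M[F]_(m2, n)) (H : 'M[F]_n) :
  col_mx V1 V2 *m H *m adj (col_mx V1 V2) =
  block_mx (V1 *m H *m adj V1) (V1 *m H *m adj V2)
           (V2 *m H *m adj V1) (V2 *m H *m adj V2).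
Proof. by rewrite /adj tr_col_mx map_row_mx mul_col_mx mul_col_row. Qed.

Lemma gram_eq0 m1 m2 n (V1 : 'M[F]_(m1, n)) (V2 : 'M[F]_(m2, n)) (H E1 E2 :
  'M[F]_n) :
    V1 *m E1 = V1 -> V2 *m E2 = V2 -> E1 *m H *m adj E2 = 0 ->
  V1 *m H *m adj V2 = 0.
Proof.
move=> <- <- E12; rewrite adjM.
have -> : V1 *m E1 *m H *m (adj E2 *m adj V2) = V1 *m (E1 *m H *m adj E2) *m adj V2.
  by rewrite !mulmxA.
by rewrite E12 mulmx0 mul0mx.
Qed.

Lemma gram_unit n (Y H : 'M[F]_n) :
  Y \in unitmx -> H \in unitmx -> Y *m H *m adj Y \in unitmx.
Proof. by move=> uY uH; rewrite !unitmx_mul uY uH adj_unit. Qed.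

Lemma special_unitary_gram n (Y H X : 'M[F]_n) : Y \in unitmx ->
    special_unitary (Y *m H *m adj Y) X ->
  special_unitary H (invmx Y *m X *m Y).
Proof.
move=> uY /andP[dX /eqP XH]; rewrite /special_unitary unimodularJ //=.
apply/eqP; rewrite -{2}[H](mulKmx uY) -[Y *m H](mulmxK (_ : adj Y \in unitmx))
  ?adj_unit //.
by rewrite -XH !adjM adj_inv !mulmxA.
Qed.

(** Orthogonality makes the Gram matrix block diagonal, so both restricted forms are nondegenerate,
    as an induction on the summands requires. *)
Lemma unitary_glue K n m1 m2 (V1 : 'M[F]_(m1, n)) (V2 : 'M[F]_(m2, n)) A A1 A2 H :
    (m1 + m2)%N = n -> row_free (col_mx V1 V2) ->
    V1 *m A = A1 *m V1 -> V2 *m A = A2 *m V2 ->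
    H \in unitmx -> adj H = H -> V1 *m H *m adj V2 = 0 ->
    (V1 *m H *m adj V1 \in unitmx ->
       conj_trivial K (special_unitary (V1 *m H *m adj V1)) A1) ->
    (V2 *m H *m adj V2 \in unitmx ->
       conj_trivial K (special_unitary (V2 *m H *m adj V2)) A2) ->
  conj_trivial K (special_unitary H) A.
Proof.
move=> e; subst n => fV VA1 VA2 uH aH V12 t1 t2.
have V21 : V2 *m H *m adj V1 = 0.
  by rewrite -(adj_gram2 V1 V2 aH) V12 adj0.
have gY := gram_col_mx V1 V2 H; rewrite V12 V21 in gY.
move: (fV); rewrite row_free_unit => uY.
have := gram_unit uY uH; rewrite gY unitmxE det_ublock unitrM -!unitmxE.
move=> /andP[u1 u2].
pose R X := special_unitary H (invmx (col_mx V1 V2) *m X *m col_mx V1 V2).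
apply: (conj_trivial_similar (P := R) (A := block_mx A1 0 0 A2) uY) => //.
  by rewrite mul_block_col [RHS]mul_col_mx !mul0mx addr0 add0r VA1 VA2.
apply: conj_trivial_block (t1 u1) (t2 u2).
move=> X1 X2 /andP[/eqP d1 /eqP h1] /andP[/eqP d2 /eqP h2].
apply: special_unitary_gram => //; rewrite gY /special_unitary /unimodular.
rewrite det_ublock d1 d2 mulr1 eqxx /=.
rewrite /adj tr_block_mx map_block_mx !trmx0 !map_mx0 !mulmx_block.
by rewrite !(mul0mx, mulmx0, addr0, add0r) [X1 *m _ *m _]h1 [X2 *m _ *m _]h2.
Qed.

(** Applied to Gram matrices, this expresses that complementary isotropic subspaces are dual to each
    other. *)
Lemma block_antidiag_unit m n (B : 'M[F]_(m, n)) (C : 'M[F]_(n, m)) :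
  block_mx 0 B C 0 \in unitmx -> m = n /\ row_free B.
Proof.
rewrite -row_free_unit => fr.
have free : row_free B.
  apply: inj_row_free => x xB; have /eqP : row_mx x 0 *m block_mx 0 B C 0 = 0.
    by rewrite mul_row_block !(mulmx0, mul0mx) xB !addr0 row_mx0.
  by rewrite mulmx_free_eq0 // row_mx_eq0 => /andP[/eqP].
have freeC : row_free C.
  apply: inj_row_free => x xC; have /eqP : row_mx 0 x *m block_mx 0 B C 0 = 0.
    by rewrite mul_row_block !(mulmx0, mul0mx) xC !addr0 row_mx0.
  by rewrite mulmx_free_eq0 // row_mx_eq0 => /andP[_ /eqP].
split=> //; apply/eqP; rewrite eqn_leq.
by rewrite -{1}(eqP free) rank_leq_col -{1}(eqP freeC) rank_leq_col.
Qed.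

(* Conjugators of A1 act on the dual isotropic summand by inverse adjoints. *)
Lemma hyperbolic_trivial n m1 m2 (V1 : 'M[F]_(m1, n)) (V2 : 'M[F]_(m2, n)) A A1
  A2 H :
    (m1 + m2)%N = n -> row_free (col_mx V1 V2) ->
    V1 *m A = A1 *m V1 -> V2 *m A = A2 *m V2 -> A *m H *m adj A = H ->
    H \in unitmx -> adj H = H ->
    V1 *m H *m adj V1 = 0 -> V2 *m H *m adj V2 = 0 ->
  conj_trivial 12 (special_unitary H) A.
Proof.
move=> e; subst n => fV VA1 VA2 AH uH aH V11 V22.
have := gram_col_mx V1 V2 H; rewrite V11 V22 => gY.
move: (fV); rewrite row_free_unit => uY.
have := gram_unit uY uH; rewrite gY => /block_antidiag_unit[e]; subst m2.
have [B BE] : exists B, B = V1 *m H *m adj V2 by exists (V1 *m H *m adj V2).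
rewrite -BE in gY *; rewrite row_free_unit => uB.
have aB : V2 *m H *m adj V1 = adj B by rewrite BE adj_gram2.
rewrite aB in gY.
have uA : A \in unitmx by move: uH; rewrite -{1}AH !unitmx_mul => /andP[/andP[]].
have uA1 : A1 \in unitmx := restrict_unitmx (row_free_col_mxl fV) VA1 uA.
(* For invertible M, [phi M] is the only matrix that together with M preserves the pairing [B]. It
   is multiplicative, so the relation for [A1] carries over to [A2]. *)
pose phi (M : 'M[F]_m1) := adj (invmx B *m invmx M *m B).
have uphi M : M \in unitmx -> phi M \in unitmx.
  by move=> uM; rewrite adj_unit !unitmx_mul !unitmx_inv uM uB.
have phiM M N : M \in unitmx -> N \in unitmx -> phi (M *m N) = phi M *m phi N.
  move=> uM uN; rewrite /phi -adjM invmxM // !mulmxA mulmxK //.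
have phi1 : phi 1%:M = 1%:M by rewrite /phi invmx1 mulmx1 mulVmx // adj1.
have phiV M : M \in unitmx -> phi (invmx M) = invmx (phi M).
  move=> uM; rewrite -[LHS]mulmx1 -(mulmxV (uphi _ uM)) mulmxA -phiM ?unitmx_inv //.
  by rewrite mulVmx // phi1 mul1mx.
have phiE M N : M \in unitmx -> M *m B *m adj N = B -> N = phi M.
  move=> uM MBN; have uMB : M *m B \in unitmx by rewrite unitmx_mul uM.
  rewrite /phi -[LHS]adjK; congr adj; rewrite -invmxM // -[LHS](mulKmx uMB) MBN.
  by rewrite invmxM.
have A2E : A2 = phi A1.
  apply: phiE => //; rewrite BE -[in RHS]AH.
  by rewrite !mulmxA -VA1 -(mulmxA _ (adj V2)) -adjM -VA2 adjM !mulmxA.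
have [X [uX X1]] := conj_trivial_GL_F4 uA1.
pose R X := special_unitary H (invmx (col_mx V1 V2) *m X *m col_mx V1 V2).
apply: (conj_trivial_similar (P := R) (A := block_mx A1 0 0 A2) uY) => //.
  by rewrite mul_block_col [RHS]mul_col_mx !mul0mx addr0 add0r VA1 VA2.
exists (fun i => block_mx (X i) 0 0 (phi (X i))).
have ub i : block_mx (X i) 0 0 (phi (X i)) \in unitmx.
  have /andP[ui _] := uX i.
  by rewrite unitmxE det_ublock unitrM -!unitmxE ui uphi.
split=> [i|].
  rewrite ub /=; have /andP[ui /eqP di] := uX i.
  apply: special_unitary_gram => //; rewrite gY /special_unitary /unimodular.
  have dphi : \det (phi (X i)) = 1.
    rewrite /phi /adj det_map_mx det_tr !det_mulmx !det_inv di invr1 mulr1.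
    by rewrite mulVr ?rmorph1 // -unitmxE.
  rewrite det_ublock di dphi mulr1 eqxx /=.
  have XB : X i *m B *m adj (phi (X i)) = B.
    by rewrite /phi adjK !mulmxA mulmxK // mulmxV // mul1mx.
  have BX : phi (X i) *m adj B *m adj (X i) = adj B.
    by rewrite -{2}XB !adjM adjK mulmxA.
  rewrite {2}/adj tr_block_mx map_block_mx !trmx0 !map_mx0 !mulmx_block.
  by rewrite !(mul0mx, mulmx0, addr0, add0r) [X i *m _ *m _]XB [phi _ *m _ *m _]BX.
pose XA i := invmx (X i) *m A1 *m X i; pose YB i := phi (XA i).
have <- : \prod_(i < 12) block_mx (XA i) 0 0 (YB i) = 1%:M.
  rewrite prod_block_diag X1.
  suff -> : \prod_(i < 12) YB i = phi (\prod_(i < 12) XA i).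
    by rewrite X1 phi1 -scalar_mx_block.
  suff [] : \prod_(i < 12) XA i \in unitmx /\ \prod_(i < 12) YB i = phi
    (\prod_(i < 12) XA i) by [].
  elim/big_rec2: _ => [|i M N _ [uN ->]]; first by rewrite unitmx1 phi1.
  have /andP[ui _] := uX i; have uXA : XA i \in unitmx.
    by rewrite !unitmx_mul unitmx_inv ui uA1.
  by rewrite -!mulmxE unitmx_mul uXA phiM.
apply: eq_bigr => i _; have /andP[ui _] := uX i.
rewrite invmx_block_diag // !mulmx_block !(mul0mx, mulmx0, addr0, add0r).
by rewrite /YB /XA !phiM ?unitmx_mul ?unitmx_inv ?ui ?uA1 // phiV // A2E.
Qed.

(** * Arbitrary isometries *)

Lemma mul_adj_delta_eq0 m n (Z : 'M[F]_(m, n)) :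
  (forall i, Z *m adj (delta_mx 0 i : 'rV_n) = 0) -> Z = 0.
Proof.
move=> Z0; apply/matrixP=> i j; have /matrixP/(_ i 0) := Z0 j.
have -> : adj (delta_mx 0 j : 'rV_n) = delta_mx j 0.
  by apply/matrixP=> k l; rewrite adjE !mxE rmorph_nat andbC.
by rewrite -colE !mxE.
Qed.

(** Polarization: if every vector is isotropic, the two mixed terms of u and v are equal in
    characteristic 2. Replacing u by w u multiplies them by w and [theta w], whose sum is 1, so they
    vanish. *)
Lemma exists_nonisotropic n (S : 'M[F]_n) :
  S != 0 -> exists v : 'rV[F]_n, v *m S *m adj v != 0.
Proof.
move=> S0; apply/existsP; apply: contraR S0; rewrite negb_exists => /forallP iso.
have {}iso (v : 'rV[F]_n) : v *m S *m adj v = 0 by apply/eqP; have := iso v;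
  rewrite negbK.
have [w [w1 _]] := exists_omega.
have pol (u v : 'rV[F]_n) : u *m S *m adj v + v *m S *m adj u = 0.
  by have := iso (u + v); rewrite adjD !mulmxDl !mulmxDr !iso add0r addr0.
apply/eqP/row_matrixP => i; rewrite row0 rowE; set u := delta_mx _ _.
have uv (v : 'rV[F]_n) : u *m S *m adj v = 0.
  have E : v *m S *m adj u = u *m S *m adj v.
    by rewrite -[LHS]add0r -(addxx2 (u *m S *m adj v)) -addrA pol addr0.
  have := pol (w *: u) v; rewrite adjZ -!scalemxAl -scalemxAr E -scalerDl w1.
  by rewrite scale1r.
by apply: mul_adj_delta_eq0 => j; apply: uv.
Qed.

Lemma conj_trivial_unitary n (H A : 'M[F]_n) :
    H \in unitmx -> adj H = H -> A *m H *m adj A = H ->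
  conj_trivial 12 (special_unitary H) A.
Proof.
have [m] := ubnP n; elim: m n H A => // m IH [|n] H A nm uH aH AH.
  by apply: conj_trivial_expr; [apply: special_unitary1 | apply/matrixP=> -[]].
have uA : A \in unitmx by move: uH; rewrite -{1}AH !unitmx_mul => /andP[/andP[]].
(* The adjoint with respect to [H]. It sends [A] to its inverse and so preserves the centralizer of
   [A]. *)
pose sharp E := H *m adj E *m invmx H.
have sharpH E : sharp E *m H = H *m adj E by rewrite mulmxKV.
have sharpM E E' : sharp (E *m E') = sharp E' *m sharp E.
  by rewrite /sharp adjM !mulmxA mulmxKV.
have sharpK E : sharp (sharp E) = E.
  by rewrite /sharp !adjM adj_inv aH adjK !mulmxA mulmxV // mul1mx mulmxK.
have sharpD E E' : sharp (E + E') = sharp E + sharp E'.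
  by rewrite /sharp adjD mulmxDr mulmxDl.
have As : sharp A = invmx A.
  have HA : H *m adj A = invmx A *m H by rewrite -{2}AH -!mulmxA mulKmx.
  by rewrite /sharp HA mulmxK.
clearbody sharp.
have sharp_comm E : E *m A = A *m E -> sharp E *m A = A *m sharp E.
  move=> EA; have := congr1 sharp EA; rewrite !sharpM As => sEA.
  by rewrite -[RHS](mulmxKV uA) -(mulmxA A) -sEA mulKVmx.
have compl_comm E : E *m A = A *m E -> (1%:M - E) *m A = A *m (1%:M - E).
  by move=> EA; rewrite mulmxBl mulmxBr mul1mx mulmx1 EA.
have compl_nz E : E != 0 -> 1%:M - E != 1%:M :> 'M[F]_n.+1.
  by move=> E0; rewrite -subr_eq0 addrAC subrr add0r oppr_eq0.
(* A self-adjoint idempotent commuting with [A] gives an orthogonal splitting. *)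
have [/existsP[E /and5P[/eqP EA /eqP EE E0 E1 /eqP sE]]|no1] :=
  boolP [exists E : 'M[F]_n.+1,
    [&& E *m A == A *m E, E *m E == E, E != 0, E != 1%:M & sharp E == E]].
  have [rE fE] := idempotent_split EE.
  have [A1 A1E] := row_base_stable EA.
  have [A2 A2E] := row_base_stable (compl_comm _ EA).
  apply: (unitary_glue rE fE A1E A2E uH aH).
  - apply: gram_eq0 (row_base_idem EE) (row_base_idem (idem_compl EE)) _.
    by rewrite -{1}sE sharpH -mulmxA -adjM mulmxBl mul1mx EE subrr adj0 mulmx0.
  - move=> u1; apply: IH => //; first exact: leq_trans (idempotent_rank_lt EE E1) _.
      exact: (adj_gram _ aH).
    exact: (isometry_restrict A1E AH).
  - move=> u2; apply: IH => //; last exact: (isometry_restrict A2E AH).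
      exact: leq_trans (idempotent_rank_lt (idem_compl EE) (compl_nz _ E0)) _.
    exact: (adj_gram _ aH).
have no1' E : E *m A = A *m E -> E *m E = E -> sharp E = E -> E = 0 \/ E = 1%:M.
  move=> EA EE sE; have [->|E0] := eqVneq E 0; first by left.
  have [->|E1] := eqVneq E 1%:M; first by right.
  by case/existsP: no1; exists E; rewrite EA EE sE E0 E1 !eqxx.
(* If E commutes with its adjoint, their product and then their sum are self-adjoint idempotents,
   equal to 0 and 1. Hence the adjoint is 1 - E and both summands are isotropic. *)
have [/existsP[E /and5P[/eqP EA /eqP EE E0 E1 /eqP sE]]|no2] :=
  boolP [exists E : 'M[F]_n.+1,
    [&& E *m A == A *m E, E *m E == E, E != 0, E != 1%:M &
        sharp E *m E == E *m sharp E]].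
  have sEA := sharp_comm _ EA.
  have sEE : sharp E *m sharp E = sharp E by rewrite -sharpM EE.
  have P0 : E *m sharp E = 0.
    have [||||P1] := no1' (E *m sharp E); rewrite ?sharpM ?sharpK //.
    - by rewrite -mulmxA sEA mulmxA EA mulmxA.
    - by rewrite -mulmxA (mulmxA (sharp E)) sE -(mulmxA E) sEE mulmxA EE.
    case/negP: E1; apply/eqP; have [uE _] := mulmx1_unit P1.
    by rewrite -[E](mulKmx uE) EE mulVmx.
  have Q1 : E + sharp E = 1%:M.
    have [||||//] := no1' (E + sharp E).
    - by rewrite mulmxDl mulmxDr EA sEA.
    - by rewrite mulmxDl !mulmxDr EE sEE sE P0 add0r addr0.
    - by rewrite sharpD sharpK addrC.
    move=> Q0; have := congr1 (mulmx E) Q0.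
    by rewrite mulmxDr EE P0 addr0 mulmx0 => /eqP; rewrite (negPf E0).
  have sEE' : sharp E = 1%:M - E by rewrite -Q1 addrC addKr.
  have [rE fE] := idempotent_split EE.
  have [A1 A1E] := row_base_stable EA.
  have [A2 A2E] := row_base_stable (compl_comm _ EA).
  apply: (hyperbolic_trivial rE fE A1E A2E AH uH aH).
    apply: gram_eq0 (row_base_idem EE) (row_base_idem EE) _.
    by rewrite -mulmxA -sharpH mulmxA P0 mul0mx.
  apply: gram_eq0 (row_base_idem (idem_compl EE)) (row_base_idem (idem_compl EE)) _.
  by rewrite -sEE' -mulmxA -sharpH sharpK mulmxA sE P0 mul0mx.
(* An idempotent of F[A] commutes with its adjoint, because the latter commutes with [A]. *)
have lA : local_mx A.
  move=> q E EE; have [->|E0] := eqVneq E 0; first by left.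
  have [->|E1] := eqVneq E 1%:M; first by right.
  have EA : E *m A = A *m E by apply: comm_horner_mx.
  case/existsP: no2; exists E; rewrite EA EE E0 E1 !eqxx /=.
  by apply/eqP; apply: comm_mx_horner; apply: sharp_comm.
have [p [k pd]] := local_mx_primary lA; have [ip pm pA pA'] := pd.
have [d sp] := primary_size pd.
(* Such a [v] generates a cyclic subspace on which the form is nondegenerate, so the orthogonal
   complement is a complement. *)
have [v vv] : exists v : 'rV[F]_n.+1, v *m (horner_mx A (p ^+ k) *m H) *m adj v
  != 0.
  apply: exists_nonisotropic; apply: contra pA' => /eqP E.
  by rewrite -[X in X == _](mulmxK uH) E mul0mx.
pose K := krylov d.+1 A v; pose L := H *m adj K.
have L0 (u : 'rV[F]_n.+1) r : u *m L = 0 -> u *m H *m adj (v *m horner_mx A r) = 0.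
  by rewrite (krylov_mod _ _ sp pd) adjM mulmxA -(mulmxA u) => ->; rewrite mul0mx.
(* The inverse of [A] is a polynomial in [A], so the orthogonal complement of the cyclic subspace is
   stable. *)
have [f f0 Af] := unitmx_expr_order uA.
have iA : invmx A = horner_mx A 'X^(f.-1).
  rewrite rmorphXn /= horner_mx_X -[RHS](mulKmx uA) mulmxE -exprS prednK //.
  by rewrite Af -mulmxE mulmx1.
have AHi : A *m H = H *m adj (invmx A).
  by rewrite -[LHS](mulmxK (_ : adj A \in unitmx)) ?adj_unit // AH adj_inv.
have [||C [A2 [sC pC e fV [KA VA]]]] := cyclic_split (L := L) (v := v) pd sp.
- move=> u uL; rewrite /L mulmxA -(mulmxA u A) AHi mulmxA -(mulmxA _ (adj _)) -adjM.
  apply: mul_adj_delta_eq0 => i; rewrite -(mulmxA _ (adj _)) -adjM mulmxA -rowE.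
  have XiE : A ^+ i = horner_mx A 'X^i by rewrite rmorphXn /= horner_mx_X.
  rewrite rowK -(mulmxA v) iA XiE mulmxE -rmorphM.
  exact: L0.
- apply: contra vv => /eqP vL; apply/eqP.
  have vE : v = delta_mx 0 ord0 *m K by rewrite -rowE rowK expr0 mulmx1.
  by rewrite {2}vE adjM !mulmxA -(mulmxA _ H) vL mul0mx.
have V2L : row_base (kermx L) *m L = 0 by apply/sub_kermxP; rewrite eq_row_base.
apply: (unitary_glue e fV KA VA uH aH).
- by rewrite -adj_gram2 // -mulmxA V2L adj0.
- move=> u1; have h1 := adj_gram K aH; have i1 := isometry_restrict KA AH.
  have [tp|tp] := eqVneq (map_poly theta p) p; last first.
    exact: (conj_trivial_shift_nonreal u1 h1 i1 sC ip pm sp pC tp).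
  apply: (conj_trivial_shift_real u1 h1 i1 sC (monic_exp _ pm) sp pC).
  by rewrite rmorphXn /= tp.
move=> u2; apply: IH => //; [|exact: (adj_gram _ aH) | exact:
  (isometry_restrict VA AH)].
apply: (@leq_trans (d.+1 + \rank (kermx L))); last by rewrite e.
by rewrite addSn ltnS leq_addl.
Qed.
End Unitary.

(** * Projective groups *)

(** Over the field of order 2 the rank one perturbation of the identity squares to 1, so two pairs
    of conjugates suffice. *)
Lemma conj_trivial_shift_F2 (F : finFieldType) (oF : #|F| = 2%N) n (C : 'M[F]_n) :
  shift_mx C -> C \in unitmx -> conj_trivial 4 (@unimodular F n) C.
Proof.
case: n C => [|n] C sC uC.
  by apply: conj_trivial_expr; [apply: unimodular1 | apply/matrixP=> -[]].
have dR : unimodular (rev_mx F n.+1).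
  by rewrite /unimodular; have := expf_card (\det (rev_mx F n.+1)); rewrite oF
    det_rev_sqr => <-.
apply: (@conj_trivial_rev _ 2) => [|Y|]; [exact: unimodular1 | exact:
  unimodularM |].
have ch2 : 2%N \in [pchar F] := @card_finPcharP F 2 1 oF isT.
have := last_row_mx_expr_char2 ch2 (or_introl oF) (shift_rev_last_row sC).
rewrite oF addrC subrK; apply.
by rewrite !unitmx_mul uC rev_mx_unit.
Qed.

Section Groups.
Import GroupScope.

Lemma GLval_prod n (F : finFieldType) K (X : 'I_K -> {'GL_n[F]}) :
  GLval (\prod_(i < K) X i)%g = (\prod_(i < K) GLval (X i))%R.
Proof. by apply: (big_morph (@GLval n F)) => // A B; rewrite GL_MxE mulmxE. Qed.

(** A relation between conjugates in [G] maps to one in the quotient by the centre, and [e_elt] is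
    the least length of such a relation. *)
Lemma e_group_quotient_le n (F : finFieldType) (G : {group {'GL_n[F]}}) K
    (P : {'GL_n[F]} -> pred 'M[F]_n.-1.+1) : (0 < K)%N ->
    (forall A X, A \in G -> P A (GLval X) -> X \in G) ->
    (forall A, A \in G -> conj_trivial K (P A) (GLval A)) ->
  (e_group (G / 'Z(G))%G <= K)%N.
Proof.
move=> K0 PG tr; apply/bigmax_leqP => _ /morphimP[A nA GA ->].
rewrite /e_elt; case: ex_minnP => m _; apply.
have [X [uX X1]] := tr A GA.
have uX' i : X i \is a GRing.unit by have /andP[] := uX i.
(* The default value 1 is never taken, since every [X i] is invertible. *)
pose Y i : {'GL_n[F]} := insubd (1 : {'GL_n[F]}) (X i).
have YE i : GLval (Y i) = X i by apply: insubdK (uX' i).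
have YG i : Y i \in G by apply: (PG A) => //; rewrite YE; have /andP[] := uX i.
rewrite /trivial_conj_product K0 /=; apply/existsP.
exists [ffun i : 'I_K => coset 'Z(G) (Y i)]; apply/andP; split.
  by apply/forallP => i; rewrite ffunE mem_quotient.
have sGN : G \subset 'N('Z(G)) := normal_norm (center_normal G).
have YN i : Y i \in 'N('Z(G)) := subsetP sGN _ (YG i).
rewrite (eq_bigr (fun i : 'I_K => coset 'Z(G) (A ^ Y i))) => [|i _]; last first.
  by rewrite ffunE morphJ.
rewrite -(morph_prod [morphism of coset 'Z(G)]) => [|i _]; last by rewrite
  groupJ ?YN.
suff -> : \prod_(i < K) A ^ Y i = 1 by rewrite morph1.
apply: val_inj; apply: etrans (GLval_prod _) _; apply: etrans X1.
apply: eq_bigr => i _.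
by rewrite conjgE !GL_MxE GL_VxE YE mulmxA.
Qed.

Lemma SLgroupP n (F : finFieldType) (A : {'GL_n[F]}) :
  (A \in SLgroup n F) = (\det (GLval A) == 1)%R.
Proof. by rewrite inE. Qed.

Lemma e_group_PSL_le n (F : finFieldType) K : (0 < K)%N ->
    (forall m (A : 'M[F]_m), A \in unitmx -> conj_trivial K (@unimodular F m) A) ->
  (e_group (PSL n F) <= K)%N.
Proof.
move=> K0 tr; apply: (e_group_quotient_le (P := fun=> @unimodular F n.-1.+1)) => //.
  by move=> A X _ dX; rewrite SLgroupP.
by move=> A _; apply: tr; apply: GL_unitmx.
Qed.

End Groups.

(** * Unitary groups through the Gram matrix of the form *)

Section PSU4.
Local Open Scope ring_scope.
Variables (n : nat) (F : finFieldType) (oF : #|F| = 4%N).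
Variable f : {hermitian_sym 'rV[F]_n.-1.+1 for conj_F4 oF}.

Let H : 'M[F]_n.-1.+1 := \matrix_(i, j) f (delta_mx 0 i) (delta_mx 0 j).

Lemma form_gram u v : f u v = (u *m H *m adj (conj_F4 oF) v) 0 0.
Proof.
rewrite [RHS]mxE.
transitivity (\sum_j \sum_i u 0 i * H i j * conj_F4 oF (v 0 j)); last first.
  by apply: eq_bigr => j _; rewrite adjE [(u *m H) 0 j]mxE mulr_suml.
rewrite exchange_big {1}(row_sum_delta u) linear_sumlz; apply: eq_bigr => i _.
rewrite linearZl_LR {1}(row_sum_delta v) linear_sumr /= mulr_sumr.
apply: eq_bigr => j _; rewrite linearZr_LR /= /H mxE.
by rewrite -mulrA; congr (_ * _); rewrite mulrC.
Qed.

Lemma delta_gram (M : 'M[F]_n.-1.+1) i j :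
  ((delta_mx 0 i : 'rV_n.-1.+1) *m M *m
     adj (conj_F4 oF) (delta_mx 0 j : 'rV_n.-1.+1)) 0 0 = M i j.
Proof.
have -> : adj (conj_F4 oF) (delta_mx 0 j : 'rV_n.-1.+1) = delta_mx j 0.
  by apply/matrixP=> k l; rewrite adjE !mxE rmorph_nat andbC.
by rewrite -rowE -colE !mxE.
Qed.

Lemma gram_herm : adj (conj_F4 oF) H = H.
Proof.
by apply/matrixP=> i j; rewrite adjE /H !mxE [RHS]hermC /= expr0 mul1r.
Qed.

Lemma gram_nondegenerate : nondegenerate f -> H \in unitmx.
Proof.
move=> nf; rewrite -row_free_unit; apply: inj_row_free => u uH.
apply/eqP; rewrite -memv0 -(eqP nf); apply/mem_orthovP => v _.
by rewrite form_gram uH mul0mx mxE.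
Qed.

Lemma mem_SUgroup (X : {'GL_n[F]}) :
  (X \in SUgroup f) = special_unitary (conj_F4 oF) H (GLval X).
Proof.
rewrite inE SLgroupP /special_unitary /unimodular; congr (_ && _).
apply/forallP/eqP => [fX | XH u].
  apply/matrixP => i j; have /forallP/(_ (delta_mx 0 j))/eqP := fX (delta_mx 0 i).
  rewrite !form_gram adjM => E; rewrite -[LHS]delta_gram -[RHS]delta_gram -E.
  by rewrite !mulmxA.
apply/forallP => v; rewrite !form_gram adjM -[in X in _ == X]XH.
by rewrite !mulmxA.
Qed.

Lemma e_group_PSU_le : is_unitary f -> (e_group (PSU f) <= 12)%N.
Proof.
move=> [/gram_nondegenerate uH _].
apply: (e_group_quotient_le (P := fun=> special_unitary (conj_F4 oF) H)) => //.
  by move=> A X _ dX; rewrite mem_SUgroup.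
move=> A; rewrite mem_SUgroup => /andP[_ /eqP AH].
exact: (conj_trivial_unitary oF (@conj_F4E F oF) uH gram_herm AH).
Qed.
End PSU4.

Theorem proposition1p4 :
  forall n : nat, (2 <= n)%N ->
  [/\ (e_group (PSL n 'F_2) <= 6)%N,
      (e_group (PSL n 'F_3) <= 6)%N
    & forall (F : finFieldType) (oF : #|F| = 4%N)
        (f : {hermitian_sym 'rV[F]_n.-1.+1 for conj_F4 oF}%R),
        is_unitary f -> (e_group (PSU f) <= 18)%N].
Proof.
(* The unitary bound obtained is 12. *)
move=> n _; split; last by move=> F oF f uf; apply: leq_trans (e_group_PSU_le uf) _.
- have o2 : #|'F_2| = 2 by rewrite card_Fp.
  (* Over the field of order 2 the relations have length 4. *)
  apply: (@leq_trans 4) => //; apply: e_group_PSL_le => // m A.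
  exact: (conj_trivial_GL (conj_trivial_shift_F2 o2)).
apply: e_group_PSL_le => // m A.
have o3 : #|'F_3| = 3 by rewrite card_Fp.
exact: (conj_trivial_GL (conj_trivial_shift_F3 o3)).
Qed.
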